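(* Let $\tau$ be an uncountable regular cardinal, $n\geq 1$ a natural number, $K=P([0,\tau]^n)$, $x=(x_1,\ldots,x_n)\in[0,\tau]^n$ and $k=|\{i : x_i=\tau\}|$. Then $$\mathbb{O}^\tau_{\delta_x}(K)\cong P_k=\Big\{t\in[0,1]^{2^k} : \sum_{i\in 2^k}t_i=1\Big\}$$ endowed with the order $t\leq s$ if and only if $\sum_{i\in A}t_i\leq\sum_{i\in A}s_i$ for every upwards closed subset $A$ of $2^k$.
   Context: All compact spaces are Hausdorff. $2^k$ denotes the power set of $\{1,\ldots,k\}$ ordered by inclusion. $[0,\tau]$ carries the order topology. $P(X)$ is the space of Radon probability measures on $X$ with the weak$^*$ topology; $\delta_x$ is the Dirac measure at $x$. Fiber orders: for a continuous map $f:X\to Y$ and $y\in Y$, the fiber $\mathbb{F}_y(f)=f^{-1}(y)$ is preordered by: $s\leq t$ iff for every neighborhood $U$ of $s$ there is a neighborhood $V$ of $t$ with $f(V)\subset f(U)$. $\mathbb{O}_y(f)=\mathbb{F}_y(f)/\sim$ is the associated ordered set, where $s\sim t$ iff $s\leq t$ and $t\leq s$. For a compact space $X$ of weight at least $\tau$, $\mathcal{Q}_\tau(X)$ is the set of all Hausdorff quotient spaces $L$ of $X$ of weight strictly less than $\tau$, with canonical projections $p_L:X\to L$ (a quotient is identified with its equivalence relation on $X$), ordered by: $L\leq L'$ iff there is a continuous surjection $q:L'\to L$ (called the natural projection) with $q\,p_{L'}=p_L$. Suprema correspond to intersections of the equivalence relations. A set $\mathcal{S}\subset\mathcal{Q}_\tau(X)$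 is cofinal if every $L\in\mathcal{Q}_\tau(X)$ satisfies $L\leq L'$ for some $L'\in\mathcal{S}$; it is a $\tau$-semilattice if the supremum of every subset of $\mathcal{S}$ of cardinality less than $\tau$ belongs to $\mathcal{S}$. For $z\in X$ and an ordered set $O$, ''$\mathbb{O}^\tau_z(X)\cong O$'' means: there is a cofinal $\tau$-semilattice $\mathcal{S}\subset\mathcal{Q}_\tau(X)$ such that for all $L<L'$ in $\mathcal{S}$ with natural projection $q:L'\to L$, the ordered set $\mathbb{O}_{p_L(z)}(q)$ is order-isomorphic to $O$.
   Formalization: A τ-semilattice is required to contain suprema only of nonempty subsets of cardinality less than τ; with the empty subset allowed, the one-point quotient would belong to it, making a fiber order trivial and the claim false for k ≥ 1. *)

(* Defs.v *)
From HB Require Import structures.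
From mathcomp Require Import all_boot all_order all_algebra.
From mathcomp Require Import all_classical all_reals all_analysis.

Set Implicit Arguments.
Unset Strict Implicit.
Unset Printing Implicit Defensive.
Import Order.TTheory GRing.Theory Num.Theory.
Import numFieldNormedType.Exports.

Local Open Scope classical_set_scope.
Local Open Scope ring_scope.
Local Open Scope card_scope.
Local Open Scope quotient_scope.

(* The library only has the non-strict comparison of cardinals; [#<=] is total
   by choice, so its failure is the strict comparison in the other direction. *)
Definition card_lt T U (A : set T) (B : set U) : Prop := ~~ (B #<= A).

Definition order_isomorphic d1 d2 (O1 : porderType d1) (O2 : porderType d2) :=
  exists2 phi : O1 -> O2, bijective phi & {mono phi : x y / (x <= y)%O}.

(* Up to isomorphism an ordinal is a well-ordered type; it is a cardinal when
   it is initial, i.e. strictly larger than each of its proper segments. *)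
Record uncountable_regular_cardinal d (tau : orderType d) : Prop := {
  urc_well_order : wochoice.well_order (<=%O : rel tau) ;
  urc_initial : forall a : tau,
    card_lt [set b : tau | (b < a)%O] [set: tau] ;
  urc_uncountable : ~ countable [set: tau] ;
  urc_regular : forall A : set tau, card_lt A [set: tau] ->
    exists b : tau, forall a, A a -> (a < b)%O }.

(* The ordinal tau + 1 = [0, tau]: [Some a] is the ordinal a < tau and [None]
   is the endpoint tau. *)
Definition ordinal_succ (tau : Type) : Type := option tau.

Section ordinal_succ.
Context d (tau : orderType d).
Local Notation T := (ordinal_succ tau).

Definition ordinal_succ_le (x y : T) : bool :=
  match x, y with
  | _, None => true
  | None, Some _ => false
  | Some a, Some b => (a <= b)%O
  end.

Lemma ordinal_succ_le_refl : reflexive ordinal_succ_le.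
Proof. by case=> //= a; exact: lexx. Qed.

Lemma ordinal_succ_le_anti : antisymmetric ordinal_succ_le.
Proof. by case=> [a|] [b|] //= /le_anti ->. Qed.

Lemma ordinal_succ_le_trans : transitive ordinal_succ_le.
Proof. by case=> [a|] [b|] [c|] //=; exact: le_trans. Qed.

Lemma ordinal_succ_le_total : total ordinal_succ_le.
Proof. by case=> [a|] [b|] //=; exact: le_total. Qed.

HB.instance Definition _ := Choice.copy T (option tau).
HB.instance Definition _ := @Order.Le_isPOrder.Build d T ordinal_succ_le
  ordinal_succ_le_refl ordinal_succ_le_anti ordinal_succ_le_trans.
HB.instance Definition _ := @Order.POrder_isTotal.Build d T
  ordinal_succ_le_total.
End ordinal_succ.

Definition closed_ordinal_interval d (tau : orderType d) : Type :=
  order_topology (ordinal_succ tau).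

Section closed_ordinal_interval.
Context d (tau : orderType d).

HB.instance Definition _ := OrderTopological.copy (closed_ordinal_interval tau)
  (order_topology (ordinal_succ tau)).

Definition right_end : closed_ordinal_interval tau := None.

HB.instance Definition _ :=
  isPointed.Build (closed_ordinal_interval tau) right_end.
End closed_ordinal_interval.
Arguments right_end {d tau}.

Definition ordinal_cube d (tau : orderType d) (n : nat) : Type :=
  prod_topology (fun _ : 'I_n => closed_ordinal_interval tau).

HB.instance Definition _ d (tau : orderType d) (n : nat) :=
  Topological.copy (ordinal_cube tau n)
    (prod_topology (fun _ : 'I_n => closed_ordinal_interval tau)).
HB.instance Definition _ d (tau : orderType d) (n : nat) :=
  isPointed.Build (ordinal_cube tau n) (fun=> right_end).

(* A library measure is a function on all sets, with arbitrary values on the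
   non-measurable ones. [radon_borel] fixes these values, so that two elements
   are equal iff they agree as Borel measures. *)
Record radon_probability (R : realType) (X : ptopologicalType) := {
  radon_measure :> probability (g_sigma_algebraType (@open X)) R ;
  radon_inner : forall A : set (g_sigma_algebraType (@open X)), measurable A ->
    radon_measure A =
      ereal_sup [set radon_measure K | K in [set K : set X |
                                             compact K /\ K `<=` A]] ;
  radon_borel : forall A : set (g_sigma_algebraType (@open X)),
    ~ measurable A -> radon_measure A = 0%E }.

Section weak_star_topology.
Context (R : realType) (X : ptopologicalType).
Local Notation P := (radon_probability R X).

HB.instance Definition _ := gen_eqMixin P.
HB.instance Definition _ := gen_choiceMixin P.

(* The measures as functionals on C(X), for the topology of pointwise
   convergence. *)
Definition radon_functional (mu : P) : {ptws continuousType X R -> R} :=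
  fun f => Rintegral mu setT f.

HB.instance Definition _ :=
  Topological.copy P (initial_topology radon_functional).
End weak_star_topology.

Section radon_dirac.
Context (R : realType) (X : ptopologicalType) (x : X).
Local Notation B := (g_sigma_algebraType (@open X)).
Local Open Scope ereal_scope.

Definition borel_dirac (A : set B) : \bar R :=
  if `[< measurable A >] then (\d_(x : B) : set B -> \bar R) A else 0.

Lemma borel_diracE (A : set B) : measurable A -> borel_dirac A = \d_(x : B) A.
Proof. by move=> mA; rewrite /borel_dirac asboolT. Qed.

Let borel_dirac0 : borel_dirac set0 = 0.
Proof. by rewrite borel_diracE// measure0. Qed.

Let borel_dirac_ge0 A : 0 <= borel_dirac A.
Proof. by rewrite /borel_dirac; case: ifP. Qed.

Let borel_dirac_sigma_additive : semi_sigma_additive borel_dirac.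
Proof.
move=> F mF tF mUF; rewrite borel_diracE//.
under eq_fun do under eq_bigr do rewrite borel_diracE//.
exact: (@measure_semi_sigma_additive _ _ _ (\d_(x : B))).
Qed.

HB.instance Definition _ := isMeasure.Build _ _ _ borel_dirac
  borel_dirac0 borel_dirac_ge0 borel_dirac_sigma_additive.

Let borel_diracT : borel_dirac setT = 1.
Proof. by rewrite borel_diracE// diracT. Qed.

HB.instance Definition _ :=
  Measure_isProbability.Build _ _ _ borel_dirac borel_diracT.

Hypothesis hX : hausdorff_space X.

Lemma borel_dirac_inner (A : set B) : measurable A ->
  borel_dirac A = ereal_sup [set borel_dirac K | K in [set K : set X |
                                                       compact K /\ K `<=` A]].
Proof.
move=> mA; apply/eqP; rewrite eq_le; apply/andP; split; last first.
  apply: ge_ereal_sup => _ [K [_ KA] <-]; rewrite (borel_diracE mA).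
  rewrite /borel_dirac; case: asboolP => // mK.
  by apply: le_measure => //; rewrite inE.
rewrite borel_diracE// diracE; apply: ereal_sup_ubound => /=.
case: (boolP ((x : B) \in A)) => [/set_mem Ax|_].
- exists [set x]; first by split; [exact: compact_set1 | move=> _ ->].
  rewrite borel_diracE; first by rewrite diracE mem_set.
  rewrite -[X in measurable X]setCK; apply: (@measurableC _ B).
  apply: sub_gen_smallest; rewrite /= openC.
  by apply: compact_closed => //; exact: compact_set1.
- exists set0; first by split; [exact: compact0 | exact: sub0set].
  by rewrite borel_diracE// measure0.
Qed.

Lemma borel_dirac_borel (A : set B) : ~ measurable A -> borel_dirac A = 0.
Proof. by move=> nA; rewrite /borel_dirac asboolF. Qed.

Definition radon_dirac : radon_probability R X :=
  {| radon_measure := borel_dirac ;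
     radon_inner := borel_dirac_inner ;
     radon_borel := borel_dirac_borel |}.
End radon_dirac.

Lemma ordinal_cube_hausdorff d (tau : orderType d) n :
  hausdorff_space (ordinal_cube tau n).
Proof. by apply: hausdorff_product => i; exact: order_hausdorff. Qed.

Section antisymmetrization.
Context d (T : preorderType d).

Definition preorder_equiv : rel T := fun s t => (s <= t)%O && (t <= s)%O.

Lemma preorder_equiv_refl : reflexive preorder_equiv.
Proof. by move=> s; rewrite /preorder_equiv lexx. Qed.

Lemma preorder_equiv_sym : symmetric preorder_equiv.
Proof. by move=> s t; rewrite /preorder_equiv andbC. Qed.

Lemma preorder_equiv_trans : transitive preorder_equiv.
Proof.
move=> t s u /andP[st ts] /andP[tu ut].
by rewrite /preorder_equiv (le_trans st tu) (le_trans ut ts).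
Qed.

Canonical preorder_equiv_rel :=
  EquivRel preorder_equiv preorder_equiv_refl preorder_equiv_sym
    preorder_equiv_trans.

Definition antisymmetrization : Type := {eq_quot preorder_equiv_rel}.
Local Notation Q := antisymmetrization.

HB.instance Definition _ := Choice.copy Q {eq_quot preorder_equiv_rel}.

Definition antisymmetrization_le (a b : Q) : bool :=
  (repr (a : {eq_quot preorder_equiv_rel})
     <= repr (b : {eq_quot preorder_equiv_rel}))%O.

Lemma antisymmetrization_le_refl : reflexive antisymmetrization_le.
Proof. by move=> a; exact: lexx. Qed.

Lemma antisymmetrization_le_anti : antisymmetric antisymmetrization_le.
Proof.
move=> a b ab; rewrite -[a]reprK -[b]reprK; apply/eqmodP.
exact: ab.
Qed.

Lemma antisymmetrization_le_trans : transitive antisymmetrization_le.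
Proof. by move=> b a c; exact: le_trans. Qed.

HB.instance Definition _ := @Order.Le_isPOrder.Build d Q antisymmetrization_le
  antisymmetrization_le_refl antisymmetrization_le_anti
  antisymmetrization_le_trans.

(* The order does not depend on the chosen representatives. *)
Lemma antisymmetrization_leE (s t : T) :
  ((\pi_{eq_quot preorder_equiv_rel} s : Q)
     <= (\pi_{eq_quot preorder_equiv_rel} t : Q))%O = (s <= t)%O.
Proof.
rewrite /Order.le /= /antisymmetrization_le.
have rep u : preorder_equiv (repr (\pi_{eq_quot preorder_equiv_rel} u)) u.
  by apply/(@eqmodP _ preorder_equiv_rel); rewrite reprK.
have /andP[rs sr] := rep s; have /andP[rt tr] := rep t.
by apply/idP/idP => [h|h]; [exact: le_trans sr (le_trans h rt)
                           | exact: le_trans rs (le_trans h tr)].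
Qed.
End antisymmetrization.

Fact fiber_display : Order.disp_t. Proof. exact: Order.Disp tt tt. Qed.

Section fiber_order.
Context (X Y : topologicalType) (f : X -> Y) (y : Y).

Definition fiber : Type := set_type (f @^-1` [set y]).
HB.instance Definition _ := Choice.copy fiber (set_type (f @^-1` [set y])).
Definition fiber_val (s : fiber) : X := set_val s.

Definition fiber_le (s t : fiber) : bool :=
  `[< forall U, nbhs (fiber_val s) U ->
      exists2 V, nbhs (fiber_val t) V & f @` V `<=` f @` U >].

Lemma fiber_le_refl : reflexive fiber_le.
Proof. by move=> s; apply/asboolP => U sU; exists U. Qed.

Lemma fiber_le_trans : transitive fiber_le.
Proof.
move=> t s u /asboolP st /asboolP tu; apply/asboolP => U /st[V /tu[W uW WV] VU].
by exists W => //; exact: subset_trans WV VU.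
Qed.

HB.instance Definition _ := @Order.Le_isPreorder.Build fiber_display fiber
  fiber_le fiber_le_refl fiber_le_trans.

Definition fiber_order : porderType fiber_display := antisymmetrization fiber.
End fiber_order.

(* Quotient spaces of X are given by equivalence relations on X. *)
Section quotient_spaces.
Context (X : topologicalType).

Definition quotient_space (L : equiv_rel X) : topologicalType :=
  quotient_topology {eq_quot L}.

Definition quotient_proj (L : equiv_rel X) : X -> quotient_space L :=
  \pi_(quotient_topology {eq_quot L}).

Definition natural_projection (L L' : equiv_rel X)
    (q : quotient_space L' -> quotient_space L) : Prop :=
  [/\ continuous q, set_surj setT setT q &
      q \o quotient_proj L' = quotient_proj L].

Definition quotient_le (L L' : equiv_rel X) : Prop :=
  exists q, @natural_projection L L' q.

Definition quotient_lt (L L' : equiv_rel X) : Prop :=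
  quotient_le L L' /\ ~ quotient_le L' L.

End quotient_spaces.

Definition weight_lt (X : topologicalType) (tau : Type) : Prop :=
  exists2 B : set (set X), basis B & card_lt B [set: tau].

Section quotient_semilattices.
Context (tau : Type) (X : topologicalType).
Implicit Types (S F : set (equiv_rel X)).

Definition small_quotients : set (equiv_rel X) :=
  [set L | hausdorff_space (quotient_space L) /\
           weight_lt (quotient_space L) tau].

Definition cofinal_quotients S : Prop :=
  forall L, small_quotients L -> exists2 L', S L' & quotient_le L L'.

Definition quotient_sup F (L : equiv_rel X) : Prop :=
  [/\ small_quotients L, forall M, F M -> quotient_le M L &
      forall N, small_quotients N -> (forall M, F M -> quotient_le M N) ->
        quotient_le L N].

(* Only suprema of nonempty families: the supremum of the empty one is the
   one-point quotient, over which every fiber order is trivial. *)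
Definition tau_semilattice S : Prop :=
  forall F, F `<=` S -> F !=set0 -> card_lt F [set: tau] ->
    exists2 L, S L & quotient_sup F L.

Definition local_order_cong (z : X) d (O : porderType d) : Prop :=
  exists S, [/\ S `<=` small_quotients, cofinal_quotients S,
    tau_semilattice S &
    forall (L L' : equiv_rel X) (q : quotient_space L' -> quotient_space L),
      S L -> S L' -> quotient_lt L L' -> natural_projection q ->
      order_isomorphic (fiber_order q (quotient_proj L z)) O].
End quotient_semilattices.

Definition up_closed k (A : {set {set 'I_k}}) : bool :=
  [forall i in A, forall j : {set 'I_k}, (i \subset j) ==> (j \in A)].

Definition cube_simplex (R : realType) k : Type :=
  {t : {ffun {set 'I_k} -> R} |
    [forall i, 0 <= t i <= 1] && (\sum_i t i == 1)}.

Fact simplex_display : Order.disp_t. Proof. exact: Order.Disp tt tt. Qed.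

Section cube_simplex.
Context (R : realType) (k : nat).
Local Notation P := (cube_simplex R k).

HB.instance Definition _ := Choice.copy P
  {t : {ffun {set 'I_k} -> R} |
    [forall i, 0 <= t i <= 1] && (\sum_i t i == 1)}.

Definition cube_simplex_le (t s : P) : bool :=
  [forall A : {set {set 'I_k}}, up_closed A ==>
    (\sum_(i in A) sval t i <= \sum_(i in A) sval s i)].

Lemma cube_simplex_le_refl : reflexive cube_simplex_le.
Proof. by move=> t; apply/forallP => A; rewrite lexx implybT. Qed.

Lemma cube_simplex_le_trans : transitive cube_simplex_le.
Proof.
move=> s t u /forallP ts /forallP su; apply/forallP => A; apply/implyP => uA.
by apply: le_trans (implyP (ts A) uA) (implyP (su A) uA).
Qed.

Lemma cube_simplex_le_anti : antisymmetric cube_simplex_le.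
Proof.
move=> t s /andP[/forallP ts /forallP st]; apply/val_inj/ffunP => i.
have eqA A : up_closed A ->
    \sum_(j in A) sval t j = \sum_(j in A) sval s j.
  by move=> uA; apply/le_anti; rewrite (implyP (ts A) uA) (implyP (st A) uA).
pose U : {set {set 'I_k}} := [set j : {set 'I_k} | i \subset j]%SET.
pose V : {set {set 'I_k}} := (U :\ i)%SET.
have uU : up_closed U.
  apply/forall_inP => a; rewrite inE => ia; apply/forallP => b.
  by apply/implyP => ab; rewrite inE; exact: fintype.subset_trans ia ab.
have uV : up_closed V.
  apply/forall_inP => a; rewrite !inE => /andP[ai ia]; apply/forallP => b.
  apply/implyP => ab; rewrite !inE (fintype.subset_trans ia ab) andbT.
  apply: contra ai => /eqP bi; rewrite finset.eqEsubset ia andbT -bi.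
  by [].
have iU : i \in U by rewrite inE.
have := eqA _ uU; rewrite (finset.big_setD1 i iU) [RHS](finset.big_setD1 i iU).
by rewrite /= (eqA _ uV) => /addIr.
Qed.

HB.instance Definition _ := @Order.Le_isPOrder.Build simplex_display P
  cube_simplex_le cube_simplex_le_refl cube_simplex_le_anti
  cube_simplex_le_trans.
End cube_simplex.

(* Main.v *)
(* For a in [0, tau]^n let F mu a = mu {y | y <= a}. The boxes {y | y <= a} are
   clopen, closed under intersection and span a uniformly dense subspace of the
   continuous functions, so the maps mu |-> F mu a generate the weak* topology of
   K = P([0, tau]^n). Let L_al identify mu and nu when F mu = F nu on
   ([0, al) + {tau})^n; as a space it is P([0, al]^n). The semilattice consists of
   the L_al for the limit ordinals al above all the coordinates x_i < tau.

   Cofinality. Let p : K -> L have weight < tau. By regularity, for each mu some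
   al_mu < tau is such that p nu = p mu as soon as nu and mu are L_{al_mu}
   equivalent. Close al under s |-> al_mu for the uniform measures mu on finite
   sequences s from the grid ([0, al) + {tau})^n. Then p nu = p (min(-, al) nu)
   for all uniform nu on finite sequences, and these are dense in K.

   Fibres of L_be -> L_al over delta_x. Assign to y the set of those i with
   x_i = tau and y_i > al; then mu in the fibre is assigned its distribution
   t(mu) on 2^k. If mu <= nu then t(mu)(A) <= t(nu)(A) for A upwards closed:
   lowering the coordinates of nu in (c, al] to c changes nu little for c < al
   close to al, and afterwards nu{ {i | y_i > al} in A } can be read off L_al.
   Conversely, if t(mu) <= t(nu), a coupling of t(mu) and t(nu) carried by
   inclusions (Hall's theorem for real weights) tells how to rearrange the
   coordinates above al, which L_al does not see, so as to turn every nu' close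
   to nu into some mu' close to mu with the same image in L_al. *)
From HB Require Import structures.
Require Import Defs.
From mathcomp Require Import all_boot all_order all_algebra.
From mathcomp Require Import all_classical all_reals all_analysis.
From mathcomp Require Import lra.

Set Implicit Arguments.
Unset Strict Implicit.
Unset Printing Implicit Defensive.
Import Order.TTheory GRing.Theory Num.Theory.
Import numFieldNormedType.Exports.

Local Open Scope classical_set_scope.
Local Open Scope ring_scope.

(** * Bounding sets *)

Section regular_cardinal.
Context d (tau : orderType d) (htau : uncountable_regular_cardinal tau).
Local Open Scope order_scope.
Local Open Scope card_scope.

Lemma tau_least (A : set tau) : A !=set0 ->
  exists2 m, A m & forall b, A b -> m <= b.
Proof.
move=> [a Aa]; have [m [[Am lm] _]] : exists! m,
    wochoice.minimum_of <=%O [pred x | `[< A x >]] m.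
  by apply: (urc_well_order htau); exists a; apply/asboolP.
exists m; first exact/asboolP.
by move=> b Ab; apply: lm; apply/asboolP.
Qed.

Lemma tau_inhabited : exists a : tau, True.
Proof.
apply: contrapT => h; apply: (urc_uncountable htau).
suff -> : [set: tau] = set0 by [].
by rewrite predeqE => a; split=> // _; apply: h; exists a.
Qed.

(* Same as [card_lt A [set: tau]], but stable under products and finite sequences
   without any cardinal arithmetic. *)
Definition bounding T (A : set T) :=
  forall f : T -> tau, exists b, forall x, A x -> f x < b.

(** Regularity applies to the image of [A] under [f], which is no larger than [A]. *)
Lemma card_lt_bounding T (A : set T) : card_lt A [set: tau] -> bounding A.
Proof.
move=> Alt f; have [|b hb] := urc_regular htau (A := f @` A).
  by apply: contra Alt => h; apply: card_le_trans h (card_image_le _ _).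
by exists b => x Ax; apply: hb; exists x.
Qed.

Lemma sub_bounding T (A B : set T) : A `<=` B -> bounding B -> bounding A.
Proof. by move=> AB bB f; have [b hb] := bB f; exists b => x /AB; exact: hb. Qed.

Lemma bounding_image T U (g : T -> U) (A : set T) :
  bounding A -> bounding (g @` A).
Proof.
by move=> bA f; have [b hb] := bA (f \o g); exists b => _ [x Ax <-]; exact: hb.
Qed.

Lemma bounding1 T (x : T) : bounding [set x].
Proof.
apply: card_lt_bounding; apply/negP => /(sub_countable); move/(_ (countable1 x)).
exact: urc_uncountable htau.
Qed.

Lemma tau_gt (a : tau) : exists b, a < b.
Proof. by have [b hb] := bounding1 a id; exists b; exact: hb. Qed.

(** Otherwise [A] would map onto [tau], and the bound of that map on [A] would be one of its
    values. *)
Lemma bounding_card_lt T (A : set T) : bounding A -> card_lt A [set: tau].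
Proof.
move=> bA; apply/negP; have [a0 _] := tau_inhabited.
pose pt := HB.pack_for pointedType tau (isPointed.Build tau a0).
move=> /(@pcard_surjP pt)[g sg]; have [b hb] := bA g.
by have [x Ax gxb] := sg b I; have := hb _ Ax; rewrite gxb ltxx.
Qed.

Lemma bounding_bigcup T U (A : set T) (F : T -> set U) :
  bounding A -> (forall x, A x -> bounding (F x)) -> bounding (\bigcup_(x in A) F x).
Proof.
move=> bA bF f; have [a0 _] := tau_inhabited.
have /choice[g hg] : forall x, exists b, A x -> forall u, F x u -> f u < b.
  move=> x; have [Ax|nAx] := pselect (A x); last by exists a0.
  by have [b hb] := bF _ Ax f; exists b.
have [b hb] := bA g; exists b => u [x Ax Fu].
exact: lt_trans (hg _ Ax _ Fu) (hb _ Ax).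
Qed.

Lemma bounding_prod T U (A : set T) (B : set U) :
  bounding A -> bounding B -> bounding (A `*` B).
Proof.
move=> bA bB; apply: (@sub_bounding _ _ (\bigcup_(x in A) [set (x, y) | y in B])).
  by move=> [x y] [/= Ax By]; exists x => //; exists y.
by apply: bounding_bigcup => // x _; exact: bounding_image.
Qed.

Lemma bounding_countable T (A : set T) : countable A -> bounding A.
Proof.
move=> cA; apply: card_lt_bounding; apply/negP => h.
by apply: (urc_uncountable htau); exact: sub_countable cA.
Qed.

Lemma boundingU T (A B : set T) : bounding A -> bounding B -> bounding (A `|` B).
Proof.
move=> bA bB f; have [a ha] := bA f; have [b hb] := bB f.
exists (Order.max a b) => x [/ha|/hb] h; rewrite lt_max h ?orbT //.
Qed.

Definition all_in T (A : set T) : set (seq T) := fun s => foldr (fun x P => A x /\ P) True s.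

Lemma all_inP (T : eqType) (A : set T) s : all_in A s <-> forall x, x \in s -> A x.
Proof.
elim: s => [|x s IH] /=; first by split.
split=> [[Ax /IH h] y|h]; first by rewrite inE => /orP[/eqP ->|/h].
by split; [apply: h; rewrite mem_head|apply/IH => y ys; apply: h; rewrite inE ys orbT].
Qed.

(** Sequences of a fixed length are bounding by induction through products, and there are only
    countably many lengths. *)
Lemma bounding_seq T (A : set T) : bounding A -> bounding (all_in A).
Proof.
move=> bA.
apply: (@sub_bounding _ _ (\bigcup_(m in [set: nat]) [set s | all_in A s /\ size s = m])).
  by move=> s As; exists (size s).
apply: bounding_bigcup => [|m _]; first exact: bounding_countable.
elim: m => [|m IH].
  by apply: sub_bounding (bounding1 [::]) => s [_ /size0nil].
apply: sub_bounding (bounding_image (fun p => p.1 :: p.2) (bounding_prod bA IH)).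
by case=> [|x s] [As] // [ss]; case: As => Ax As; exists (x, s).
Qed.

(** * Suprema and limit ordinals below [tau] *)

Definition limit_ordinal (a : tau) :=
  (exists b, b < a) /\ forall b, b < a -> exists2 c, b < c & c < a.

Lemma bounding_lt (a : tau) : bounding [set b | b < a].
Proof. by apply: card_lt_bounding; exact: urc_initial. Qed.

Lemma exists_lub (A : set tau) b0 : A !=set0 -> (forall a, A a -> a < b0) ->
  exists m, (forall a, A a -> a <= m) /\ forall b, b < m -> exists2 a, A a & b < a.
Proof.
move=> A0 Ab.
have [|m mA ml] := tau_least (A := [set b | forall a, A a -> a <= b]).
  by exists b0 => a /Ab/ltW.
exists m; split=> // b bm; apply: contrapT => h.
have /ml : [set b | forall a, A a -> a <= b] b.
  by move=> a Aa; rewrite leNgt; apply/negP => ba; apply: h; exists a.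
by rewrite leNgt bm.
Qed.

(** Iterating a step beyond both [a] and [g a] gives an increasing sequence; it is bounded because
    countable sets are bounding, and [m] is its supremum. *)
Lemma limit_closure (a0 : tau) (g : tau -> tau) :
  exists m, [/\ a0 < m, limit_ordinal m &
    forall b, b < m -> exists2 c, b < c & c < m /\ g c <= m].
Proof.
have /choice[nx hnx] : forall a, exists b, a < b /\ g a < b.
  move=> a; have [b hb] := tau_gt (Order.max a (g a)); exists b.
  by move: hb; rewrite gt_max => /andP.
pose u n := iter n nx a0.
have [b hb] := bounding_countable (countableP [set: nat]) u.
have [||m [um ml]] := @exists_lub (range u) b.
- by exists (u 0%N); exists 0%N.
- by move=> _ [n _ <-]; exact: hb.
have uS n : u n < u n.+1 by have [] := hnx (u n).
have ult n : u n < m by apply: lt_le_trans (uS n) _; apply: um; exists n.+1.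
exists m; split.
- exact: (ult 0%N).
- split=> [|c /ml[_ [n _ <-] cn]]; first by exists a0; exact: (ult 0%N).
  by exists (u n).
- move=> c /ml[_ [n _ <-] cn]; exists (u n) => //; split=> //.
  by have [_ /ltW/le_trans] := hnx (u n); apply; exact: um (ex_intro2 _ _ n.+1 _ _).
Qed.

Lemma finite_bound (I : eqType) (s : seq I) (a m : tau) (P : I -> option tau) :
  a < m -> (forall i b, i \in s -> P i = Some b -> b < m) ->
  exists c, [/\ a <= c, c < m & forall i b, i \in s -> P i = Some b -> b <= c].
Proof.
move=> am; elim: s => [|i s IH] Pm; first by exists a.
have [|c [ac cm cP]] := IH; first by move=> j b js; apply: Pm; rewrite inE js orbT.
exists (Order.max c (odflt a (P i))); split.
- by rewrite le_max ac.
- rewrite gt_max cm; case E: (P i) => [b|//] /=.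
  by apply: Pm E; rewrite mem_head.
- move=> j b; rewrite inE => /orP[/eqP -> E|js E]; first by rewrite E le_max lexx orbT.
  by rewrite le_max (cP _ _ js E).
Qed.

End regular_cardinal.

(** * The cube [0, tau]^n *)

Lemma cvg_initial (S : choiceType) (T : topologicalType) (f : S -> T)
    (F : set_system S) (s : S) : Filter F ->
  f @ F --> f s -> F --> (s : initial_topology f).
Proof.
move=> FF cvF A [_ [[B oB <-] /= Bs BA]].
by apply: filterS BA _; apply: cvF; exact: open_nbhs_nbhs.
Qed.

Lemma cvg_prod_topology (I : eqType) (T : I -> topologicalType)
    (F : set_system (prod_topology T)) (f : prod_topology T) : Filter F ->
  (forall i, (fun g : prod_topology T => g i) @ F --> f i) -> F --> f.
Proof.
by move=> FF h; apply/cvg_sup => i; apply: cvg_initial; exact: h.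
Qed.

Lemma clopen_forall (I : finType) (T : topologicalType) (P : I -> set T) :
  (forall i, clopen (P i)) -> clopen [set z | forall i, P i z].
Proof.
move=> cP; have -> : [set z | forall i, P i z] = \big[setI/setT]_(i <- enum I) P i.
  rewrite -bigcap_seq; apply/seteqP; split=> z h i; first by move=> _; exact: h.
  by apply: h; rewrite /= mem_enum.
by apply: (big_ind (@clopen T)) => [|A B|i _]; [exact: clopenT|exact: clopenI|exact: cP].
Qed.

(** * Order topology of the interval [0, tau] *)

Section interval.
Context d (tau : orderType d) (htau : uncountable_regular_cardinal tau).
Local Notation T := (closed_ordinal_interval tau).
Local Open Scope order_scope.

Lemma le_right_end (y : T) : y <= right_end.
Proof. by case: y. Qed.

Lemma some_le (a b : tau) : ((Some a : T) <= Some b) = (a <= b).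
Proof. by []. Qed.

Lemma some_lt (a b : tau) : ((Some a : T) < Some b) = (a < b).
Proof. by rewrite !ltNge some_le. Qed.

Lemma some_lt_right_end (a : tau) : (Some a : T) < right_end.
Proof. by rewrite lt_neqAle le_right_end. Qed.

Lemma interval_least (A : set T) : A !=set0 ->
  exists2 m, A m & forall b, A b -> m <= b.
Proof.
move=> A0; have [[a Aa]|h] := pselect (exists a, A (Some a)).
  have [m Am ml] := tau_least htau (A := [set a | A (Some a)]) (ex_intro _ a Aa).
  by exists (Some m) => // -[b /ml|]//; rewrite le_right_end.
case: A0 => -[a Aa|AN]; first by case: h; exists a.
by exists None => // -[b Ab|//]; case: h; exists b.
Qed.

Lemma interval_succ (a : T) : a != right_end ->
  exists b, a < b /\ forall c, (c < b) = (c <= a).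
Proof.
case: a => [a _|]; last by rewrite eqxx.
have [b ab] := tau_gt htau a.
have [|m am ml] := interval_least (A := [set c | (Some a : T) < c]).
  by exists (Some b); rewrite /= some_lt.
exists m; split=> // c; apply/idP/idP => [cm|ca]; last exact: le_lt_trans ca am.
by rewrite leNgt; apply/negP => /ml; rewrite leNgt cm.
Qed.

(** The closed ray below [a] is also the open ray below the successor of [a]; only the endpoint has
    no successor, and there the ray is everything. *)
Lemma clopen_le (a : T) : clopen [set y : T | y <= a].
Proof.
split; last first.
  have -> : [set y : T | y <= a] = `]-oo, a]%classic by apply/seteqP; split=> y;
      rewrite /= in_itv.
  exact: lray_closed.
have [->|/interval_succ[b [_ hb]]] := eqVneq a right_end.
  have -> : [set y : T | y <= right_end] = setT; last exact: openT.
  by apply/seteqP; split=> y //= _; exact: le_right_end.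
have -> : [set y : T | y <= a] = `]-oo, b[%classic; last exact: lray_open.
by apply/seteqP; split=> y; rewrite /= in_itv /= hb.
Qed.

(** Only the left end of an open interval around [y] is kept; the second alternative is an interval
    unbounded to the left. *)
Lemma interval_nbhs (y : T) U : nbhs y U ->
  (exists2 c, c < y & forall z, c < z <= y -> U z) \/ forall z, z <= y -> U z.
Proof.
rewrite itv_nbhsE => -[[l r] [/= oe yi] sU].
have {}sU z : z <= y -> (l <= BLeft z)%O -> U z.
  move=> zy lz; apply: sU; move: yi; rewrite /= !itv_boundlr lz => /andP[_ /=].
  by apply: le_trans; rewrite bnd_simp.
case: l oe yi sU => [[] c|[]] oe; rewrite itv_boundlr => /andP[yl yr] sU.
- by move: oe; rewrite /itv_open_ends /=; case: r {yr}.
- left; exists c => // z /andP[cz zy]; exact: sU.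
- by right=> z zy; apply: sU.
- by [].
Qed.

(** An ultrafilter converges to the least [m] whose closed lower ray it contains: for [c < m] it
    contains the complement of the ray below [c]. *)
Lemma interval_compact : compact [set: T].
Proof.
rewrite compact_ultra => F FU _.
have [|m Fm ml] := interval_least (A := [set a | F [set y : T | y <= a]]).
  exists right_end => /=; apply: (@filterS _ _ _ setT) => [y _|]; last exact: filterT.
  exact: le_right_end.
exists m; split=> // U /interval_nbhs[[c cm cU]|mU]; last exact: filterS Fm.
have Fc : F (~` [set y : T | y <= c]).
  by have [/ml|//] := in_ultra_setVsetC [set y : T | y <= c] FU; rewrite leNgt cm.
apply: filterS (filterI Fc Fm) => z [/= /negP]; rewrite -ltNge => cz zm.
by apply: cU; rewrite cz.
Qed.

End interval.

(** * Boxes and neighbourhoods in the cube *)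

Section cube.
Context d (tau : orderType d) (htau : uncountable_regular_cardinal tau) (n : nat).
Local Notation T := (closed_ordinal_interval tau).
Local Notation X := (ordinal_cube tau n).
Local Open Scope order_scope.

Definition cle (y a : X) : bool := [forall i, (y i : T) <= a i].

Lemma cleP (y a : X) : reflect (forall i, (y i : T) <= a i) (cle y a).
Proof. exact: forallP. Qed.

Definition cmin (a b : X) : X := fun i => Order.min (a i : T) (b i).

Lemma cle_min y a b : cle y (cmin a b) = cle y a && cle y b.
Proof.
apply/cleP/andP => [h|[/cleP ha /cleP hb] i]; last by rewrite le_min ha hb.
by split; apply/cleP => i; have := h i; rewrite le_min => /andP[].
Qed.

Lemma ccoord_continuous i : continuous (fun y : X => y i : T).
Proof. exact: (@proj_continuous _ (fun _ : 'I_n => T) i). Qed.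

Lemma clopen_coord i (a : T) : clopen [set y : X | (y i : T) <= a].
Proof.
exact: (@preimage_clopen X T (fun y => y i) _ (clopen_le htau a) (@ccoord_continuous i)).
Qed.

Lemma clopen_cle a : clopen [set y : X | cle y a].
Proof.
have -> : [set y : X | cle y a] = [set y : X | forall i, (y i : T) <= a i].
  by apply/seteqP; split=> y /cleP.
by apply: clopen_forall => i; exact: clopen_coord.
Qed.

Lemma cube_compact : compact [set: X].
Proof.
have := @tychonoff 'I_n (fun _ => T) (fun=> setT) (fun=> interval_compact htau).
by congr compact; apply/seteqP; split.
Qed.

(** The sets in the conclusion are the base of a filter, so its convergence to [y] can be tested one
    coordinate at a time. *)
Lemma cube_nbhs (y : X) U : nbhs y U ->
  exists2 s : seq X, ~~ has (cle y) s & forall z, cle z y -> ~~ has (cle z) s -> U z.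
Proof.
pose F := filter_from [set s : seq X | ~~ has (cle y) s]
  (fun s => [set z | cle z y /\ ~~ has (cle z) s]).
have FF : Filter F.
  apply: filter_from_filter; first by exists [::].
  move=> s t /= ys yt; exists (s ++ t); first by rewrite /= has_cat negb_or ys.
  by move=> z [zy]; rewrite has_cat negb_or => /andP[? ?].
suff /(_ U) h : F --> y by move=> /h[s ys sU]; exists s => // z zy zs; exact: sU.
apply: cvg_prod_topology => i V /(interval_nbhs) hV.
case: hV => [[c cy cV]|yV].
(* This box constrains coordinate [i] alone, so leaving it means that coordinate [i] exceeds [c]. *)
- exists [:: (fun j => if j == i then c else right_end) : X] => /=.
    rewrite orbF; apply/negP => /cleP /(_ i); rewrite eqxx leNgt cy //.
  move=> z [/cleP zy]; rewrite orbF => /negP nz; apply: cV; rewrite zy andbT ltNge.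
  apply/negP => zc; apply: nz; apply/cleP => j; case: eqP => [->//|_].
  exact: le_right_end.
- by exists [::] => // z [/cleP zy _]; apply: yV.
Qed.

Lemma cube_continuous (Y : topologicalType) (h : Y -> X) :
  (forall i (a : T), clopen [set y | (h y i : T) <= a]) -> continuous h.
Proof.
move=> ch y U /cube_nbhs[s ys sU].
have oc (a : X) : clopen [set z | cle (h z) a].
  have -> : [set z | cle (h z) a] = [set z | forall i, (h z i : T) <= a i].
    by apply/seteqP; split=> z /cleP.
  by apply: clopen_forall => i; exact: ch.
have : nbhs y [set z | cle (h z) (h y) /\ ~~ has (cle (h z)) s].
  apply: filterI.
    by apply: open_nbhs_nbhs; split; [have [] := oc (h y)|apply/cleP].
  elim: s ys {sU} => [|a s IH] /=; first by move=> _; apply: nearW.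
  rewrite negb_or => /andP[ya /IH ys].
  have : nbhs y (~` [set z | cle (h z) a]).
    apply: open_nbhs_nbhs; split; last exact/negP.
    by rewrite openC; have [] := oc a.
  by apply: filterS2 ys => z /= zs /negP za; rewrite negb_or za.
by apply: filterS => z [zy zs]; exact: sU.
Qed.

End cube.

(** * Radon probability measures *)

Section radon.
Context (R : realType) (X : ptopologicalType) (hX : hausdorff_space X).
Local Notation B := (g_sigma_algebraType (@open X)).
Local Notation K := (radon_probability R X).

Definition borel (A : set X) : Prop := @measurable _ B A.

Lemma open_borel (A : set X) : open A -> borel A.
Proof. exact: sub_gen_smallest. Qed.

Lemma closed_borel (A : set X) : closed A -> borel A.
Proof.
move=> cA; rewrite -(setCK A); apply: (@measurableC _ B).
by apply: open_borel; rewrite openC.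
Qed.

Lemma clopen_borel (A : set X) : clopen A -> borel A.
Proof. by case=> oA _; exact: open_borel. Qed.

Lemma compact_borel (A : set X) : compact A -> borel A.
Proof. by move=> /(compact_closed hX)/closed_borel. Qed.

Lemma continuous_borel (h : X -> X) (A : set X) :
  continuous h -> borel A -> borel (h @^-1` A).
Proof.
move=> ch bA; rewrite -[_ @^-1` _]setTI.
apply: (@measurability _ _ B B _ h (@open X)) => //.
by move=> _ [U oU <-]; rewrite setTI; apply: open_borel; exact: open_comp.
Qed.

Definition inner_regular (m : set B -> \bar R) := forall A, borel A ->
  forall e : R, 0 < e -> exists C : set X, [/\ compact C, C `<=` A & (m A <= m C + e%:E)%E].

(** Resetting [m] to zero off the Borel sets gives the normal form demanded by [radon_borel] without
    changing it as a Borel measure. *)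
Lemma radon_extension (m : {measure set B -> \bar R}) :
  m setT = 1%E -> inner_regular m ->
  exists mu : K, forall A, borel A -> mu A = m A.
Proof.
move=> mT irm.
pose f (A : set B) : \bar R := if `[< measurable A >] then m A else 0%E.
have fE (A : set B) : measurable A -> f A = m A by move=> mA; rewrite /f asboolT.
have f0 : f set0 = 0%E by rewrite fE// measure0.
have f_ge0 A : (0 <= f A)%E by rewrite /f; case: ifP.
have fsa : semi_sigma_additive f.
  move=> F mF tF mUF; rewrite fE//; under eq_fun do under eq_bigr do rewrite fE//.
  exact: (@measure_semi_sigma_additive _ _ _ m).
pose fm := isMeasure.Build _ _ _ f f0 f_ge0 fsa.
pose f1 : {measure set B -> \bar R} := HB.pack f fm.
have f1T : f1 setT = 1%E by rewrite /= fE.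
pose f2 : probability B R := HB.pack f fm (Measure_isProbability.Build _ _ _ f1 f1T).
have f2E (A : set B) : measurable A -> f2 A = m A by exact: fE.
have f2in (A : set B) : measurable A ->
    f2 A = ereal_sup [set f2 K | K in [set K : set X | compact K /\ K `<=` A]].
  move=> mA; apply/eqP; rewrite eq_le; apply/andP; split; last first.
    apply: ge_ereal_sup => _ [C [cC CA] <-].
    by rewrite le_measure// inE//; exact: compact_borel.
  apply/lee_addgt0Pr => e e0; have [C [cC CA mAC]] := irm _ mA _ e0.
  rewrite f2E//; apply: le_trans mAC _; rewrite leeD2r//.
  rewrite -f2E; last exact: compact_borel.
  by apply: ereal_sup_ubound; exists C.
exists {| radon_measure := f2; radon_inner := f2in;
  radon_borel := fun A nA => ltac:(by rewrite /f2 /= /f asboolF) |} => A mA.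
exact: f2E.
Qed.

Definition pr (mu : K) (A : set X) : R := fine (mu A).

Lemma prE (mu : K) A : borel A -> mu A = (pr mu A)%:E.
Proof. by move=> mA; rewrite fineK// fin_num_measure. Qed.

Lemma pr_ge0 (mu : K) A : 0 <= pr mu A.
Proof. by rewrite fine_ge0. Qed.

Lemma pr0 (mu : K) : pr mu set0 = 0.
Proof. by rewrite /pr measure0. Qed.

Lemma prT (mu : K) : pr mu setT = 1.
Proof. by rewrite /pr probability_setT. Qed.

Lemma pr_le (mu : K) A1 A2 : borel A1 -> borel A2 -> A1 `<=` A2 -> pr mu A1 <= pr mu A2.
Proof.
by move=> m1 m2 A12; rewrite -lee_fin -!prE// le_measure// inE.
Qed.

Lemma prU (mu : K) A1 A2 : borel A1 -> borel A2 -> A1 `&` A2 = set0 ->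
  pr mu (A1 `|` A2) = pr mu A1 + pr mu A2.
Proof.
move=> m1 m2 A12; apply: EFin_inj; rewrite EFinD -!prE//; last exact: (@measurableU _ B).
by rewrite measureU.
Qed.

Lemma pr_bigU (mu : K) (I : choiceType) (s : seq I) (F : I -> set X) : uniq s ->
  (forall i, borel (F i)) -> (forall i j, i != j -> F i `&` F j = set0) ->
  borel (\bigcup_(i in [set` s]) F i) /\
  pr mu (\bigcup_(i in [set` s]) F i) = \sum_(i <- s) pr mu (F i).
Proof.
move=> us mF dF; elim: s us => [_|i s IH].
  by rewrite big_nil set_nil bigcup_set0 pr0; split=> //; exact: (@measurable0 _ B).
rewrite cons_uniq => /andP[si /IH[mU prs]]; rewrite big_cons -prs.
rewrite bigcup_seq big_cons -bigcup_seq.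
split; first exact: (@measurableU _ B _ _ (mF i) mU).
rewrite prU//; apply/seteqP; split=> // y [Fi [j /= js Fj]].
have : (F i `&` F j) y by []. 
by rewrite dF //; apply: contraNneq si => ->.
Qed.

Lemma inner_regular_radon (mu : K) : inner_regular mu.
Proof.
move=> A mA e e0.
have [|_ [C [cC CA] <-] lt] := @ub_ereal_sup_adherent R
  [set mu C | C in [set C : set X | compact C /\ C `<=` A]] e e0.
  by rewrite -radon_inner// fin_num_measure.
exists C; split=> //; move: lt; rewrite -radon_inner//.
by rewrite lteBlDr ?fin_num_measure// => /ltW.
Qed.

Lemma pr_inner (mu : K) A : borel A -> forall e, 0 < e ->
  exists C : set X, [/\ compact C, C `<=` A & pr mu A <= pr mu C + e].
Proof.
move=> mA e e0; have [C [cC CA le]] := inner_regular_radon mu mA e0.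
exists C; split=> //; rewrite -lee_fin EFinD -!prE//; exact: compact_borel.
Qed.

Lemma pr_partition (C : finType) (f : X -> C) (mu : K) (D : set X) (P : pred C) :
  borel D -> (forall c, borel [set y | f y = c]) ->
  pr mu ([set y | P (f y)] `&` D) = \sum_(c | P c) pr mu ([set y | f y = c] `&` D).
Proof.
move=> bD bf.
have bfD c : borel ([set y | f y = c] `&` D) by exact: (@measurableI _ B _ _ (bf c) bD).
have dis i j : i != j -> ([set y | f y = i] `&` D) `&` ([set y | f y = j] `&` D) = set0.
  move=> ij; apply/seteqP; split=> // y [[/= -> _] [/= ij' _]].
  by rewrite ij' eqxx in ij.
have [_] := pr_bigU mu (enum_uniq P) bfD dis; rewrite big_enum => <-.
congr pr; apply/seteqP; split=> y [].
  by move=> Py Dy; exists (f y) => //=; rewrite mem_enum.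
by move=> c /=; rewrite mem_enum => Pc [-> Dy].
Qed.

Lemma pr_dirac (x : X) A : borel A -> pr (radon_dirac R x hX) A = \1_A x.
Proof. by move=> bA; rewrite /pr /= borel_diracE. Qed.

Lemma prC (mu : K) A : borel A -> pr mu (~` A) = 1 - pr mu A.
Proof.
move=> bA; have bC : borel (~` A) by exact: (@measurableC _ B _ bA).
by rewrite -(prT mu) -(setvU A) prU// ?setICl// addrK.
Qed.

Lemma prID (mu : K) A N : borel A -> borel N ->
  pr mu A = pr mu (A `&` N) + pr mu (A `&` ~` N).
Proof.
move=> bA bN; have bC : borel (~` N) by exact: (@measurableC _ B _ bN).
rewrite -prU.
- by rewrite -setIUr setUv setIT.
- exact: (@measurableI _ B _ _ bA bN).
- exact: (@measurableI _ B _ _ bA bC).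
- by rewrite setIACA setICr setI0.
Qed.

Lemma pr_full (mu : K) A N : borel A -> borel N -> pr mu N = 1 -> pr mu (A `&` N) = pr mu A.
Proof.
move=> bA bN N1; have bC : borel (~` N) by exact: (@measurableC _ B _ bN).
rewrite (prID mu bA bN); apply/esym/eqP; rewrite -subr_eq0 addrC addKr eq_le pr_ge0 andbT.
have <- : pr mu (~` N) = 0 by rewrite prC// N1 subrr.
apply: pr_le => //; exact: (@measurableI _ B _ _ bA bC).
Qed.

(** * Finite mixtures of continuous images of a measure *)

Section mix.
Context (J : eqType) (c : J -> R) (W : J -> set X) (h : J -> X -> X) (nu : K).
Hypothesis c_ge0 : forall j, 0 <= c j.
Hypothesis clW : forall j, clopen (W j).
Hypothesis ch : forall j, continuous (h j).

Lemma borel_mix j A : borel A -> borel (W j `&` h j @^-1` A).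
Proof.
by move=> mA; apply: (@measurableI _ B); [exact: clopen_borel|exact: continuous_borel].
Qed.

(** Terms are added one at a time. Inner regularity persists because the continuous map [h j] sends
    a compact part of the preimage of [A] to a compact part of [A]. *)
Lemma mix_measure (s : seq J) : exists m : {measure set B -> \bar R},
  inner_regular m /\
  forall A, borel A -> m A = (\sum_(j <- s) c j * pr nu (W j `&` h j @^-1` A))%:E.
Proof.
elim: s => [|j s [m [irm mE]]].
  exists mzero; split=> [A mA e e0|A mA]; last by rewrite big_nil.
  by exists set0; split=> //; [exact: compact0|rewrite add0e lee_fin ltW].
pose f (A : set B) : \bar R := if `[< borel A >] then nu (W j `&` h j @^-1` A) else 0%E.
have fE (A : set B) : borel A -> f A = nu (W j `&` h j @^-1` A) by move=> mA;
    rewrite /f asboolT.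
have f0 : f set0 = 0%E.
  by rewrite fE; [rewrite preimage_set0 setI0 measure0|exact: (@measurable0 _ B)].
have f_ge0 A : (0 <= f A)%E by rewrite /f; case: ifP.
have fsa : semi_sigma_additive f.
  move=> F mF tF mUF; rewrite fE// preimage_bigcup setI_bigcupr.
  have fF k : f (F k) = nu (W j `&` h j @^-1` F k) by rewrite fE//; exact: mF.
  under eq_fun do under eq_bigr do rewrite fF.
  apply: measure_semi_sigma_additive.
  - by move=> k; apply: borel_mix; exact: mF.
  - apply/trivIsetP => k l _ _ kl; rewrite setIACA setIid -preimage_setI.
    by move/trivIsetP : tF => ->//; rewrite preimage_set0 setI0.
  - by rewrite -setI_bigcupr -preimage_bigcup; exact: borel_mix.
pose fm : {measure set B -> \bar R} := HB.pack f (isMeasure.Build _ _ _ f f0 f_ge0 fsa).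
pose m' : {measure set B -> \bar R} := measure_add (mscale (NngNum (c_ge0 j)) fm) m.
have m'E A : borel A -> m' A = (\sum_(i <- j :: s) c i * pr nu (W i `&` h i @^-1` A))%:E.
  move=> mA; have -> : m' A = ((c j)%:E * f A + m A)%E by exact: measure_addE.
  by rewrite fE// big_cons EFinD -mE// EFinM -prE//; exact: borel_mix.
exists m'; split=> // A mA e e0.
(* The tolerance [e / 2] is divided by [c j + 1], since [c j] may vanish. *)
have cpos : 0 < c j + 1 by rewrite ltr_wpDl.
have [C1 [cC1 C1A p1]] := pr_inner nu (borel_mix j mA) (divr_gt0 (divr_gt0 e0 (ltr0n _ 2))
    cpos).
have [C2 [cC2 C2A p2]] := irm A mA _ (divr_gt0 e0 (ltr0n _ 2)).
have cC : compact (h j @` C1 `|` C2).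
  by apply: compactU => //; apply: continuous_compact => //; exact: continuous_subspaceT.
exists (h j @` C1 `|` C2); split=> //.
  by move=> z [[y Cy <-]|/C2A//]; have [] := C1A _ Cy.
rewrite m'E// m'E; last exact: compact_borel.
rewrite -EFinD lee_fin !big_cons.
have le1 : c j * pr nu (W j `&` h j @^-1` A) <= c j * pr nu (W j `&` h j @^-1` (h j @` C1
    `|` C2)) + e / 2.
  apply: le_trans (ler_wpM2l (c_ge0 j) p1) _; rewrite mulrDr lerD//.
    apply: ler_wpM2l => //; apply: pr_le; [exact: compact_borel|apply: borel_mix;
        exact: compact_borel|].
    by move=> y Cy; split; [case: (C1A _ Cy)|left; exists y].
  rewrite mulrCA ler_piMr//; first by rewrite divr_ge0// ltW.
  by rewrite ler_pdivrMr// mul1r lerDl.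
have le2 : \sum_(i <- s) c i * pr nu (W i `&` h i @^-1` A) <=
    \sum_(i <- s) c i * pr nu (W i `&` h i @^-1` (h j @` C1 `|` C2)) + e / 2.
  rewrite -lee_fin EFinD -mE// -mE; last exact: compact_borel.
  apply: le_trans p2 _; rewrite leeD2r//.
  apply: le_measure; rewrite ?inE; [exact: compact_borel|exact: compact_borel|].
  by move=> y; right.
by rewrite [e in leRHS]splitr addrACA; exact: lerD.
Qed.

End mix.

(* The image of [nu] under the Markov kernel [y |-> sum_(j | W j y) c j * dirac (h j y)]. *)
Lemma radon_mix (J : finType) (c : J -> R) (W : J -> set X) (h : J -> X -> X) (nu : K) :
  (forall j, 0 <= c j) -> (forall j, clopen (W j)) -> (forall j, continuous (h j)) ->
  \sum_j c j * pr nu (W j) = 1 ->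
  exists mu : K, forall A, borel A ->
    pr mu A = \sum_j c j * pr nu (W j `&` h j @^-1` A).
Proof.
move=> c0 clW ch c1; have [m [irm mE]] := mix_measure nu c0 clW ch (index_enum J).
have [|mu muE] := radon_extension _ irm.
  rewrite mE; last exact: (@measurableT _ B).
  by under eq_bigr do rewrite preimage_setT setIT; rewrite c1.
by exists mu => A mA; rewrite /pr muE// mE.
Qed.

(** * Integrals of step functions *)

Definition esp (mu : K) (f : X -> R) : R := Rintegral mu setT f.

Definition comb (s : seq (R * set X)) (y : X) : R := \sum_(p <- s) p.1 * \1_(p.2) y.

Lemma comb_integrable (mu : K) s : (forall p, p \in s -> borel p.2) ->
  mu.-integrable setT (EFin \o comb s) /\ esp mu (comb s) = \sum_(p <- s) p.1 * pr mu p.2.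
Proof.
elim: s => [|p s IH] ms.
  have -> : comb [::] = cst 0 by apply/funext => y; rewrite /comb big_nil.
  rewrite big_nil; split; first exact: (@finite_measure_integrable_cst _ _ _ mu).
  by rewrite /esp Rintegral_cst// mul0r.
have [|i1 i2] := IH; first by move=> q qs; apply: ms; rewrite inE qs orbT.
have mp : @measurable _ B p.2 by apply: ms; rewrite mem_head.
have ip : mu.-integrable setT (EFin \o (\1_(p.2) : B -> R)).
  apply: (@measurable_bounded_integrable _ B) => //.
  - by rewrite ltey_eq fin_num_measure.
  - exists 1; split=> // M M1 y _ /=; rewrite indicE normr_nat (le_trans _ (ltW M1))//.
    by rewrite (lern1 R); case: (_ \in _).
have -> : comb (p :: s) = (fun y => p.1 * \1_(p.2) y + comb s y).
  by apply/funext => y; rewrite /comb big_cons.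
have ip1 : mu.-integrable setT (EFin \o (fun y : B => p.1 * (\1_(p.2) y : R))).
  exact: (@integrableZl _ B _ mu setT measurableT p.1 _ ip).
split; first exact: (@integrableD _ B _ mu setT measurableT _ _ ip1 i1).
rewrite /esp RintegralD// RintegralZl// big_cons -i2; congr (_ * _ + _).
by rewrite /Rintegral integral_indic// setIT.
Qed.

Lemma esp_indic (mu : K) (A : set X) : borel A -> esp mu \1_A = pr mu A.
Proof.
by move=> mA; rewrite /esp /Rintegral integral_indic// setIT.
Qed.

End radon.

(** * Neighbourhoods through box masses *)

Section box_masses.
Context (R : realType) d (tau : orderType d) (htau : uncountable_regular_cardinal tau)
    (n : nat).
Local Notation X := (ordinal_cube tau n).
Local Notation B := (g_sigma_algebraType (@open X)).
Local Notation K := (radon_probability R X).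
Let hX := @ordinal_cube_hausdorff d tau n.

Definition box_cdf (mu : K) (a : X) : R := pr mu [set y | cle y a].

Definition ctop : X := fun=> right_end.

Lemma cle_top y : cle y ctop.
Proof. by apply/cleP => i; exact: le_right_end. Qed.

(* [A] is a union of cells of the finite partition generated by the boxes [0, a], [a \in G]. *)
Definition depends_on (G : seq X) (A : set X) :=
  forall y z, (forall a, a \in G -> cle y a = cle z a) -> A y -> A z.

(** Induction on [G]: a box cuts [A] into a part inside and a part outside, and each is the trace of
    a set depending on the remaining boxes. *)
Lemma depends_on_ind (E : set X) (P : set X -> Prop) : P set0 -> P setT ->
  (forall a A1 A2, E a -> P A1 -> P A2 ->
    P (([set y | cle y a] `&` A1) `|` (~` [set y | cle y a] `&` A2))) ->
  forall G A, (forall a, a \in G -> E a) -> depends_on G A -> P A.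
Proof.
move=> P0 PT Pstep; elim=> [|a G IH] A GE dA.
  have [[y Ay]|A0] := pselect (A !=set0).
    have -> : A = setT; last by [].
    by apply/seteqP; split=> // z _; exact: dA Ay.
  have -> : A = set0; last by [].
  by apply/seteqP; split=> // y Ay; apply: A0; exists y.
(* The points that agree on the rest of [G] with a point of [A] on side [b] of the box at [a]; this
   set no longer depends on [a]. *)
pose cell b := [set z | exists y, [/\ cle y a = b, forall e, e \in G ->
    cle y e = cle z e & A y]].
have dcell b : depends_on G (cell b).
  move=> z z' zz' [y [ya yz Ay]]; exists y; split=> // e eG.
  by rewrite yz// zz'.
have -> : A = ([set y | cle y a] `&` cell true) `|` (~` [set y | cle y a] `&` cell false).
  apply/seteqP; split=> z.
    have [za|/negP za] := boolP (cle z a); first by left; split=> //; exists z.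
    by right; split=> //; exists z; split=> //; apply/negP.
  case=> -[/= za [y [ya yz Ay]]]; apply: dA Ay => e; rewrite inE => /orP[/eqP->|/yz//].
    by rewrite ya za.
  by rewrite ya; apply/esym/negP.
apply: Pstep; first by apply: GE; rewrite mem_head.
  by apply: IH (dcell _) => e eG; apply: GE; rewrite inE eG orbT.
by apply: IH (dcell _) => e eG; apply: GE; rewrite inE eG orbT.
Qed.

Lemma depends_on_clopen G A : depends_on G A -> clopen A.
Proof.
apply: (@depends_on_ind setT (@clopen X)) => // [||a A1 A2 _ c1 c2].
- exact: clopen0.
- exact: clopenT.
- have ca : clopen [set y : X | cle y a] by exact: clopen_cle.
  by apply: clopenU; apply: clopenI => //; exact: (clopenC setT ca).
Qed.

Lemma borel_cle a : borel [set y : X | cle y a].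
Proof. exact: clopen_borel (clopen_cle htau a). Qed.

Definition box_span (E : set X) (f : X -> R) := exists s : seq (R * X),
  (forall p, p \in s -> E p.2) /\ forall y, f y = \sum_(p <- s) p.1 * (cle y p.2)%:R.

Definition cdf_span (E : set X) (phi : K -> R) := exists s : seq (R * X),
  (forall p, p \in s -> E p.2) /\ forall mu, phi mu = \sum_(p <- s) p.1 * box_cdf mu p.2.

(** With [1_a] the indicator of the box at [a], the combined set has indicator
    [1_a 1_A1 + 1_A2 - 1_a 1_A2]; multiplication by [1_a] replaces a corner [b] by [cmin a b]. *)
Lemma box_span_indic (E : set X) G A : E ctop ->
  (forall a b, E a -> E b -> E (cmin a b)) ->
  (forall a, a \in G -> E a) -> depends_on G A -> box_span E \1_A.
Proof.
move=> ET EI.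
apply: (@depends_on_ind E (fun A => box_span E (\1_A : X -> R))).
- by exists [::]; split=> // y; rewrite big_nil indicE in_set0.
- exists [:: (1, ctop)]; split=> [p|y]; first by rewrite inE => /eqP ->.
  by rewrite big_seq1 cle_top indicE in_setT mulr1.
move=> a A1 A2 Ea [s1 [s1E e1]] [s2 [s2E e2]].
exists ([seq (p.1, cmin a p.2) | p <- s1] ++ s2 ++ [seq (- p.1, cmin a p.2) | p <- s2]).
split=> [p|y].
  by rewrite !mem_cat => /or3P[/mapP[q qs ->]|/s2E//|/mapP[q qs ->]]; apply: EI => //;
      [exact: s1E|exact: s2E].
rewrite !big_cat !big_map /=.
have pull (s : seq (R * X)) : \sum_(p <- s) p.1 * (cle y (cmin a p.2))%:R =
    (cle y a)%:R * \sum_(p <- s) p.1 * (cle y p.2)%:R.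
  by rewrite mulr_sumr; apply: eq_bigr => p _; rewrite cle_min -mulnb natrM mulrCA.
under [X in _ = _ + (_ + X)]eq_bigr do rewrite mulNr.
rewrite sumrN !pull -e1 -e2 !indicE in_setU !in_setI in_setC.
rewrite (_ : (y \in [set y | cle y a]) = cle y a); last by apply/idP/idP; rewrite inE.
case: (cle y a) => /=; last by rewrite !mul0r subr0 add0r.
by rewrite !mul1r subrr addr0 orbF.
Qed.

(** Integration turns the expansion of the indicator into one of the mass, with coefficients
    independent of the measure. *)
Lemma cdf_span_pr (E : set X) G A : E ctop ->
  (forall a b, E a -> E b -> E (cmin a b)) ->
  (forall a, a \in G -> E a) -> depends_on G A -> cdf_span E (fun mu => pr mu A).
Proof.
move=> ET EI GE dA; have [s [sE e]] := box_span_indic ET EI GE dA.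
exists s; split=> // mu; rewrite -esp_indic; last exact: clopen_borel (depends_on_clopen dA).
have := @comb_integrable R X mu [seq (p.1, [set y : X | cle y p.2]) | p <- s].
have -> : comb [seq (p.1, [set y : X | cle y p.2]) | p <- s] = \1_A.
  apply/funext => y; rewrite e /comb big_map; apply: eq_bigr => p _; congr (_ * _).
  by rewrite indicE /=; congr ((nat_of_bool _)%:R); apply/idP/idP; rewrite inE.
move=> [|_ ->]; first by move=> _ /mapP[p _ ->]; exact: borel_cle.
by rewrite big_map.
Qed.

Lemma cdf_span_sum (E : set X) (I : Type) (s : seq I) (c : I -> R) (phi : I -> K -> R) :
  (forall i, cdf_span E (phi i)) -> cdf_span E (fun mu => \sum_(i <- s) c i * phi i mu).
Proof.
move=> sp; elim: s => [|i s [t [tE te]]].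
  by exists [::]; split=> // mu; rewrite !big_nil.
have [u [uE ue]] := sp i.
exists ([seq (c i * p.1, p.2) | p <- u] ++ t); split=> [p|mu].
  by rewrite mem_cat => /orP[/mapP[q /uE ? ->]|/tE].
rewrite big_cons big_cat big_map -te ue mulr_sumr; congr (_ + _).
by apply: eq_bigr => p _; rewrite mulrA.
Qed.

(** With [E] the whole cube these are the weak* neighbourhoods ([radon_nbhsE]); with [E] a grid they
    describe the neighbourhoods in a truncation quotient ([truncation_nbhs]). *)
Definition cdf_nbhs (E : set X) (mu : K) : set_system K :=
  filter_from [set p : seq X * R | (forall a, a \in p.1 -> E a) /\ 0 < p.2]
    (fun p => [set nu | forall a, a \in p.1 -> `|box_cdf mu a - box_cdf nu a| < p.2]).

Global Instance cdf_nbhs_filter E mu : Filter (cdf_nbhs E mu).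
Proof.
apply: filter_from_filter; first by exists ([::], 1); split=> //=.
move=> [G1 e1] [G2 e2] [/= GE1 e10] [/= GE2 e20].
exists (G1 ++ G2, Num.min e1 e2).
  split=> /= [a|]; last by rewrite lt_min e10.
  by rewrite mem_cat => /orP[/GE1|/GE2].
move=> nu /= h; split=> a aG.
  by have := h a; rewrite mem_cat aG lt_min => /(_ isT)/andP[].
by have := h a; rewrite mem_cat aG orbT lt_min => /(_ isT)/andP[].
Qed.

Lemma cdf_span_near E mu phi e : cdf_span E phi -> 0 < e ->
  \forall nu \near cdf_nbhs E mu, `|phi mu - phi nu| < e.
Proof.
move=> [s [sE se]] e0; pose C := \sum_(p <- s) `|p.1|.
have C0 : 0 < C + 1 by rewrite ltr_wpDl// sumr_ge0.
exists ([seq p.2 | p <- s], e / (C + 1)).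
  by split=> /= [_ /mapP[p ps ->]|]; [exact: sE|rewrite divr_gt0].
move=> nu /= h; rewrite !se -sumrB.
apply: (@le_lt_trans _ _ (\sum_(p <- s) `|p.1| * (e / (C + 1)))).
  apply: le_trans (ler_norm_sum _ _ _) _; rewrite !big_seq; apply: ler_sum => p ps.
  by rewrite -mulrBr normrM ler_wpM2l// ltW// h//; apply/mapP; exists p.
rewrite -mulr_suml -/C mulrCA gtr_pMr//.
by rewrite ltr_pdivrMr// mul1r ltrDl.
Qed.

Lemma esp_continuous (f : X -> R) : continuous f -> continuous (fun mu : K => esp mu f).
Proof.
move=> cf mu; pose g := mkcts cf.
exact: (continuous_comp (@initial_continuous _ _ (@radon_functional R X) mu)
   (@proj_continuous _ (fun _ : continuousType X R => R) g (radon_functional mu))).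
Qed.

Lemma indic_continuous (A : set X) : clopen A -> continuous (\1_A : X -> R).
Proof.
move=> [oA cA] y.
apply: (@cvg_near_cst X R (\1_A y) (\1_A : X -> R) (nbhs y) _).
have [Ay|nAy] := pselect (A y).
  have : nbhs y A by exact: open_nbhs_nbhs.
  by apply: filterS => z Az; rewrite !indicE !mem_set.
have : nbhs y (~` A) by apply: open_nbhs_nbhs; split=> //; rewrite openC.
by apply: filterS => z Az; rewrite !indicE !memNset.
Qed.

Lemma pr_continuous (A : set X) : clopen A -> continuous (fun mu : K => pr mu A).
Proof.
move=> cA; have -> : (fun mu : K => pr mu A) = (fun mu => esp mu \1_A).
  by apply/funext => mu; rewrite esp_indic//; exact: clopen_borel.
exact/esp_continuous/indic_continuous.
Qed.

Lemma cdf_nbhs_sub E mu : cdf_nbhs E mu `<=` nbhs mu.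
Proof.
move=> U [[G e] [/= _ e0] GU]; apply: filterS GU _.
elim: G => [|a G IH].
  by apply: (@filterS _ (nbhs mu) _ setT) => //; exact: filterT.
have : nbhs mu [set nu | `|box_cdf mu a - box_cdf nu a| < e].
  by have /(_ mu)/cvgrPdist_lt := pr_continuous (clopen_cle htau a); apply.
by apply: filterS2 IH => nu hG ha b; rewrite inE => /orP[/eqP ->//|/hG].
Qed.

(** By compactness the cube is covered by finitely many basic sets, on each of which [f] stays
    within [e / 2] of its value at the base point; the boxes defining these sets decide membership
    in them. *)
Lemma finite_oscillation (f : X -> R) e : continuous f -> 0 < e ->
  exists G : seq X, forall y z, (forall a, a \in G -> cle y a = cle z a) -> `|f y - f z| < e.
Proof.
move=> cf e0.
have /choice[s hs] : forall y : X, exists s : seq X, ~~ has (cle y) s /\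
    forall z, cle z y -> ~~ has (cle z) s -> `|f y - f z| < e / 2.
  move=> y; have /cvgrPdist_lt/(_ (e / 2)) := cf y.
  rewrite divr_gt0// => /(_ isT)/cube_nbhs[s ys sU].
  by exists s.
pose V y := [set z | cle z y /\ ~~ has (cle z) (s y)].
have dV y : depends_on (y :: s y) (V y).
  move=> z z' zz' [zy zs]; split; first by rewrite -zz' ?mem_head.
  apply: contra zs => /hasP[a as_ za]; apply/hasP; exists a => //.
  by rewrite zz'// inE as_ orbT.
have := cube_compact htau (n := n); rewrite compact_cover => /(_ X setT V).
case=> [y _|y _|D _ cD].
- by have [] := depends_on_clopen (dV y).
- by exists y => //; split; [apply/cleP|case: (hs y)].
exists (flatten [seq y :: s y | y <- finmap.enum_fset D]) => y z yz.
have [w wD Vw] := cD y I.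
have Vz : V w z.
  apply: dV Vw => a aw; apply: yz; apply/flattenP; exists (w :: s w) => //.
  by apply/mapP; exists w.
have [_ hw] := hs w; rewrite -[e]addr0 (splitr e) addr0.
rewrite -(subrKA (f w)); apply: le_lt_trans (ler_normD _ _) _.
by rewrite distrC; apply: ltrD; apply: hw; [case: Vw|case: Vw|case: Vz|case: Vz].
Qed.

Lemma continuous_integrable (mu : K) (f : X -> R) : continuous f ->
  mu.-integrable setT (EFin \o (f : B -> R)).
Proof.
move=> cf; apply: (measurable_bounded_integrable (A := [set: B])); first exact: measurableT.
- by rewrite ltey_eq fin_num_measure.
- apply: (measurability _ (measurable_realfun.RGenOpens.measurableE R)).
  move=> _ [_ [a [b ->] <-]]; rewrite setTI; apply: open_borel.
  by move/continuousP : cf; apply; exact: interval_open.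
- have /compact_bounded[M [_ mrt]] : compact (f @` setT).
    by apply: continuous_compact; [exact: continuous_subspaceT|exact: cube_compact].
  by exists M; split; rewrite ?num_real // => N MN y _; apply: mrt MN _ _; exists y.
Qed.

(** * Finite partitions into cells and the weak* topology *)

Definition pattern (G : seq X) (y : X) : (size G).-tuple bool := map_tuple (cle y) (in_tuple G).

Definition cell (G : seq X) (c : (size G).-tuple bool) : set X := [set y | pattern G y = c].

Lemma pattern_eq G y z : pattern G y = pattern G z <-> forall a, a \in G -> cle y a = cle z a.
Proof.
by split=> [/(congr1 val) /= /eq_in_map|h]; [|apply/val_inj/eq_in_map].
Qed.

Lemma cell_depends G c : depends_on G (@cell G c).
Proof. by move=> y z /pattern_eq yz <-. Qed.

(* Junk value: the top point when the cell is empty. *)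
Definition cell_rep G (c : (size G).-tuple bool) : X := xget ctop (cell c).

Lemma pattern_rep G y : pattern G (cell_rep (pattern G y)) = pattern G y.
Proof. by rewrite /cell_rep; case: xgetP => [z _ //|/(_ y)]; case. Qed.

Lemma cell_comb G (f : X -> R) y :
  comb [seq (f (cell_rep c), cell c) | c <- index_enum ((size G).-tuple bool)] y =
  f (cell_rep (pattern G y)).
Proof.
rewrite /comb big_map (bigD1 (pattern G y)) //= indicE mem_set// mulr1.
rewrite big1 ?addr0// => c cy; rewrite indicE memNset ?mulr0//.
by rewrite /cell /= => yc; rewrite yc eqxx in cy.
Qed.

Lemma cell_borel G c : borel (@cell G c).
Proof. exact: clopen_borel (depends_on_clopen (@cell_depends G c)). Qed.

Lemma esp_cell_comb G (f : X -> R) (mu : K) :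
  let s := [seq (f (cell_rep c), cell c) | c <- index_enum ((size G).-tuple bool)] in
  mu.-integrable setT (EFin \o comb s) /\
  esp mu (comb s) = \sum_c f (cell_rep c) * pr mu (@cell G c).
Proof.
move=> s; have [|i ->] := @comb_integrable R X mu s.
  by move=> _ /mapP[c _ ->]; exact: cell_borel.
by rewrite /s big_map.
Qed.

Lemma pr_cells G A (mu : K) : depends_on G A ->
  pr mu A = \sum_c \1_A (cell_rep c) * pr mu (@cell G c).
Proof.
move=> dA; rewrite -esp_indic; last exact: clopen_borel (depends_on_clopen dA).
have [_ <-] := esp_cell_comb G \1_A mu; congr esp; apply/funext => y.
rewrite cell_comb !indicE; congr ((nat_of_bool _)%:R).
have yr : pattern G (cell_rep (pattern G y)) = pattern G y by exact: pattern_rep.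
by apply/idP/idP => /set_mem h; apply/mem_set; apply: dA h; apply/pattern_eq.
Qed.

(** [f] is within [e / 3] of a step function on cells, whose integral is a combination of box
    masses; this leaves three errors of [e / 3]. *)
Lemma esp_near mu (f : X -> R) e : continuous f -> 0 < e ->
  \forall nu \near cdf_nbhs setT mu, `|esp mu f - esp nu f| < e.
Proof.
move=> cf e0; have e30 : 0 < e / 3 by rewrite divr_gt0.
have [G hG] := finite_oscillation cf e30.
pose s := [seq (f (cell_rep c), cell c) | c <- index_enum ((size G).-tuple bool)].
have fr y : `|f y - f (cell_rep (pattern G y))| < e / 3.
  by apply/hG/pattern_eq; rewrite pattern_rep.
have approx (nu : K) : `|esp nu f - esp nu (comb s)| <= e / 3.
  have fi := continuous_integrable nu cf; have [si sE] := esp_cell_comb G f nu.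
  rewrite /esp -RintegralB//; apply: le_trans (le_normr_Rintegral _ _) _ => //.
    exact: (@integrableB _ B _ nu setT measurableT _ _ fi si).
  have := @le_Rintegral _ B _ nu setT (fun y => `|f y - comb s y|) (cst (e / 3)) measurableT.
  rewrite Rintegral_cst// -/(pr nu setT) prT mulr1; apply.
  - exact: (@integrable_norm _ B _ nu setT _ (@integrableB _ B _ nu setT measurableT _ _ fi
      si)).
  - exact: (@finite_measure_integrable_cst _ _ _ nu).
  - by move=> y _; rewrite cell_comb ltW.
have sp : cdf_span setT (fun nu => esp nu (comb s)).
  have -> : (fun nu : K => esp nu (comb s)) = fun nu =>
      \sum_c f (cell_rep c) * pr nu (@cell G c).
    by apply/funext => nu; have [_ ->] := esp_cell_comb G f nu.
  by apply: cdf_span_sum => c; exact: (cdf_span_pr (E := setT)) (@cell_depends G c).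
apply: filterS (cdf_span_near mu sp e30) => nu h.
rewrite -(subrKA (esp mu (comb s))) (_ : e = e / 3 + (e / 3 + e / 3)); last by lra.
apply: le_lt_trans (ler_normD _ _) _; apply: ler_ltD; first exact: approx.
rewrite -(subrKA (esp nu (comb s))); apply: le_lt_trans (ler_normD _ _) _.
by apply: ltr_leD => //; rewrite distrC.
Qed.

Lemma radon_nbhsE mu : nbhs mu = cdf_nbhs setT mu.
Proof.
apply/seteqP; split; last exact: cdf_nbhs_sub.
suff : cdf_nbhs setT mu --> mu by [].
apply: cvg_initial; apply: cvg_prod_topology => g.
apply/cvgrPdist_lt => e e0.
exact: (esp_near mu (@cts_fun _ _ g) e0).
Qed.

End box_masses.

(** * Truncation quotients *)

Section quotients.
Context (X : topologicalType).
Implicit Types (L : equiv_rel X).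
Local Open Scope quotient_scope.

Lemma quotient_projP L x y : reflect (quotient_proj L x = quotient_proj L y) (L x y).
Proof. exact: (@eqmodP X L). Qed.

Lemma quotient_repr L x : L (repr (quotient_proj L x)) x.
Proof. by apply/quotient_projP; exact: reprK. Qed.

Lemma quotient_projK L (u : quotient_space L) : quotient_proj L (repr u) = u.
Proof. exact: reprK. Qed.

(** Given the inclusion of relations, the natural projection is built from representatives, and it
    is continuous by the universal property of the quotient topology. *)
Lemma quotient_leP L L' : quotient_le L L' <-> forall x y, L' x y -> L x y.
Proof.
split=> [[q [_ _ qE]] x y /quotient_projP xy|LL'].
  have h z : q (quotient_proj L' z) = quotient_proj L z by rewrite -qE.
  by apply/quotient_projP; rewrite -!h xy.
have qE : (quotient_proj L \o repr) \o quotient_proj L' = quotient_proj L.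
  by apply/funext => x; apply/quotient_projP/LL'/quotient_repr.
exists (quotient_proj L \o repr); split=> //.
  by apply/quotient_continuous; rewrite qE; exact: pi_continuous.
move=> u _; exists (quotient_proj L' (repr u)) => //.
have /(congr1 (fun g => g (repr u))) /= -> := qE; exact: quotient_projK.
Qed.

Lemma open_quotient L (O : set (quotient_space L)) :
  open (quotient_proj L @^-1` O) -> open O.
Proof. by []. Qed.

Lemma quotient_proj_continuous L : continuous (quotient_proj L).
Proof. exact: pi_continuous. Qed.

End quotients.

Section truncation.
Context (R : realType) d (tau : orderType d) (htau : uncountable_regular_cardinal tau)
    (n : nat).
Local Notation T := (closed_ordinal_interval tau).
Local Notation X := (ordinal_cube tau n).
Local Notation K := (radon_probability R X).
Let hX := @ordinal_cube_hausdorff d tau n.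

(** The endpoint counts as below every [al], because as a coordinate of a corner it imposes no
    constraint. *)
Definition below (al : tau) (t : T) : bool := if t is Some b then (b < al)%O else true.

(* ([0, al) + {tau})^n; the corner tau leaves a coordinate unconstrained. *)
Definition grid (al : tau) : set X := [set a | forall i, below al (a i)].

Lemma below_min al s t : below al s -> below al t -> below al (Order.min s t).
Proof. by rewrite minEle; case: ifP. Qed.

Lemma grid_min al a b : grid al a -> grid al b -> grid al (cmin a b).
Proof. by move=> ga gb i; exact: below_min. Qed.

Lemma grid_le al be : (al <= be)%O -> grid al `<=` grid be.
Proof.
move=> ab a ga i; have := ga i; rewrite /below; case: (a i) => // b ba.
exact: lt_le_trans ab.
Qed.

(* The quotient map P([0, tau]^n) -> P([0, al]^n) induced by y |-> min(y, al). *)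
Definition cdf_rel al : rel K := fun mu nu =>
    `[< forall a, grid al a -> box_cdf mu a = box_cdf nu a >].

Lemma cdf_relP al mu nu : reflect (forall a, grid al a -> box_cdf mu a = box_cdf nu a)
    (cdf_rel al mu nu).
Proof. exact: asboolP. Qed.

Lemma cdf_rel_equiv al : [/\ reflexive (cdf_rel al), symmetric (cdf_rel al) & transitive
    (cdf_rel al)].
Proof.
split.
- by move=> mu; apply/cdf_relP.
- by move=> mu nu; apply/cdf_relP/cdf_relP => h a ga; rewrite h.
- by move=> nu mu la /cdf_relP h1 /cdf_relP h2; apply/cdf_relP => a ga; rewrite h1// h2.
Qed.

Definition truncation al : equiv_rel K :=
  let: And3 r s t := cdf_rel_equiv al in EquivRel (cdf_rel al) r s t.

Lemma truncationP al (mu nu : K) : reflect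
    (forall a, grid al a -> box_cdf mu a = box_cdf nu a) (truncation al mu nu).
Proof. by rewrite /truncation; case: cdf_rel_equiv => r s t; exact: cdf_relP. Qed.

Lemma radon_push (h : X -> X) (nu : K) : continuous h ->
  exists mu : K, forall A, borel A -> pr mu A = pr nu (h @^-1` A).
Proof.
move=> ch; have [||||mu muE] := @radon_mix R X hX unit (fun=> 1) (fun=> setT) (fun=> h) nu.
- by [].
- by move=> _; exact: clopenT.
- by [].
- by rewrite big_const card_unit /= addr0 mul1r prT.
exists mu => A mA; rewrite muE//.
by rewrite big_const card_unit /= addr0 mul1r setTI.
Qed.

(** The least corner of the grid above [a]. *)
Definition collapse al (a : X) : X := fun i => if below al (a i) then a i else right_end.

Lemma grid_collapse al a : grid al (collapse al a).
Proof. by move=> i; rewrite /collapse; case: ifP. Qed.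

Lemma collapse_id al a : grid al a -> collapse al a = a.
Proof. by move=> ga; apply/funext => i; rewrite /collapse ga. Qed.

(** Truncating a point at [al] and rounding a bound up to the grid are adjoint operations. *)
Lemma truncate_le al (t u : T) :
  (Order.min t (Some al : T) <= u)%O = (t <= if below al u then u else right_end)%O.
Proof.
rewrite ge_min; case: u => [b|] /=; last by rewrite !le_right_end.
rewrite some_le; case: ltP => ba; first by rewrite orbF.
by rewrite orbT le_right_end.
Qed.

Lemma clopen_truncate al i (u : T) : clopen [set y : X | (Order.min (y i : T)
    (Some al : T) <= u)%O].
Proof.
have -> : [set y : X | (Order.min (y i : T) (Some al : T) <= u)%O] =
    [set y : X | (y i <= if below al u then u else right_end)%O].
  by apply/seteqP; split=> y /=; rewrite truncate_le.
exact: clopen_coord.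
Qed.

Lemma truncate_exists al (mu : K) : exists nu : K, forall a, box_cdf nu a = box_cdf mu
    (collapse al a).
Proof.
have [|nu nuE] := @radon_push (fun y i => Order.min (y i : T) (Some al : T)) mu.
  by apply: cube_continuous => i u; exact: clopen_truncate.
exists nu => a; rewrite /box_cdf nuE; last exact: borel_cle.
congr (pr mu _); apply/seteqP; split=> y /cleP h; apply/cleP => i; have := h i.
  by rewrite truncate_le.
by rewrite -truncate_le.
Qed.

(** A representative of the class of [mu] whose box masses at all corners are determined by those of
    [mu] at grid corners. *)
Definition truncate al (mu : K) : K := projT1 (cid (truncate_exists al mu)).

Lemma cdf_truncate al mu a : box_cdf (truncate al mu) a = box_cdf mu (collapse al a).
Proof. by rewrite /truncate; case: cid. Qed.

Lemma truncate_rel al mu : truncation al (truncate al mu) mu.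
Proof. by apply/truncationP => a ga; rewrite cdf_truncate collapse_id. Qed.

Local Notation proj al := (quotient_proj (truncation al)).

Lemma proj_truncate al mu : proj al (truncate al mu) = proj al mu.
Proof. by apply/quotient_projP; exact: truncate_rel. Qed.

Lemma cdf_repr al mu a : grid al a -> box_cdf (repr (proj al mu)) a = box_cdf mu a.
Proof. by move=> ga; have /truncationP := quotient_repr (truncation al) mu; apply. Qed.

Lemma open_cdf (a : X) (V : set R) : open V -> open [set mu : K | V (box_cdf mu a)].
Proof.
by move=> oV; apply: open_comp oV => mu _; exact: pr_continuous (clopen_cle htau a) mu.
Qed.

(** Forwards, a neighbourhood is read at [truncate al mu], where every corner acts through its
    collapse. Backwards, a set given by grid corners is saturated, hence comes from an open set of
    the quotient. *)
Lemma truncation_nbhs al mu V :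
  nbhs (proj al mu) V <-> cdf_nbhs (grid al) mu (proj al @^-1` V).
Proof.
split=> [|[[G e] [/= Ga e0] GV]].
  rewrite nbhsE => -[U [oU Umu] UV].
  have : nbhs (truncate al mu) (proj al @^-1` U).
    apply: open_nbhs_nbhs; split; last by rewrite /= proj_truncate.
    exact: oU.
  rewrite radon_nbhsE// => -[[G e] [/= _ e0] GU].
  exists ([seq collapse al a | a <- G], e).
    by split=> //= _ /mapP[a _ ->]; exact: grid_collapse.
  move=> nu /= h; apply: UV; rewrite -(proj_truncate al nu); apply: GU => a aG.
  by rewrite !cdf_truncate; apply: h; apply/mapP; exists a.
pose U := [set u : quotient_space (truncation al) | forall a, a \in G ->
    `|box_cdf mu a - box_cdf (repr u) a| < e].
have UE : proj al @^-1` U = [set nu | forall a, a \in G -> `|box_cdf mu a - box_cdf nu a| < e].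
  by apply/seteqP; split=> nu /= h a aG; have := h a aG; rewrite cdf_repr//; exact: Ga.
have oU : open U.
  apply: open_quotient; rewrite UE.
  rewrite (_ : [set nu | _] =
      \big[setI/setT]_(a <- G) [set nu | `|box_cdf mu a - box_cdf nu a| < e]); last first.
    by rewrite -bigcap_seq; apply/seteqP; split=> nu h a /h.
  apply: (big_ind (@open K)) => [|A B|a _]; [exact: openT|exact: openI|].
  apply: (@open_cdf a [set r | `|box_cdf mu a - r| < e]).
  by have := @ball_open R R (box_cdf mu a) e; apply.
have : nbhs (proj al mu) U.
  apply: open_nbhs_nbhs; split=> // a aG.
  by rewrite cdf_repr ?subrr ?normr0//; exact: Ga.
apply: filterS => u Uu; rewrite -(quotient_projK u); apply: GV => a aG; exact: Uu.
Qed.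

(** Distinct classes differ in the mass of some box with a grid corner; half that difference is the
    radius of separating neighbourhoods. *)
Lemma truncation_hausdorff al : hausdorff_space (quotient_space (truncation al)).
Proof.
move=> u v uv; rewrite -(quotient_projK u) -(quotient_projK v).
apply/quotient_projP/truncationP => a ga; apply/eqP; rewrite -subr_eq0; apply/negPn/negP => ne.
pose e := `|box_cdf (repr u) a - box_cdf (repr v) a| / 2.
have e0 : 0 < e by rewrite divr_gt0// normr_gt0.
pose U (w : quotient_space (truncation al)) := [set w' : quotient_space (truncation al) |
  `|box_cdf (repr w) a - box_cdf (repr w') a| < e].
have nU w : nbhs w (U w).
  rewrite -[X in nbhs X](quotient_projK w); apply/truncation_nbhs.
  exists ([:: a], e); first by split=> // b /=; rewrite inE => /eqP ->.
  by move=> nu /= /(_ a (mem_head _ _)); rewrite /U /= cdf_repr.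
have [w [Uw Vw]] := uv _ _ (nU u) (nU v).
have := ler_distD (box_cdf (repr w) a) (box_cdf (repr u) a) (box_cdf (repr v) a).
rewrite leNgt => /negP; apply; rewrite [ltRHS](splitr _) ltrD//.
by rewrite distrC.
Qed.

Lemma bounding_grid al : bounding tau (grid al).
Proof.
pose C : set T := [set None] `|` Some @` [set b | (b < al)%O].
have bC : bounding tau C.
  by apply: boundingU; [exact: bounding1|apply/bounding_image/bounding_lt].
apply: sub_bounding (bounding_image (fun s : seq T => (fun i : 'I_n =>
    nth None s i) : X) (bounding_seq htau bC)).
move=> a ga; exists [seq (a i : T) | i <- enum 'I_n].
  apply/all_inP => t /mapP[i _ ->]; have := ga i; rewrite /below /C.
  by case: (a i) => [b ba|_]; [right; exists b|left].
apply/funext => i; rewrite (nth_map i) ?size_enum_ord//; congr (a _).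
exact: nth_ord_enum.
Qed.

(** Rational bounds on finitely many box masses at grid corners define a base, and such data are
    finite sequences over a bounding set. *)
Lemma truncation_weight al : weight_lt (quotient_space (truncation al)) tau.
Proof.
pose O (s : seq (X * (rat * rat))) := [set u : quotient_space (truncation al) |
  forall p, p \in s -> ratr p.2.1 < box_cdf (repr u) p.1 < ratr p.2.2].
exists (O @` all_in (grid al `*` setT)); last first.
  apply/bounding_card_lt => //; apply/bounding_image/bounding_seq => //.
  by apply: bounding_prod => //; [exact: bounding_grid|exact: bounding_countable].
split=> [_ [s /all_inP sa <-]|u V].
  apply: open_quotient.
  rewrite (_ : _ @^-1` _ = \big[setI/setT]_(p <- s) [set mu : K | ratr p.2.1 < box_cdf mu
      p.1 < ratr p.2.2]); last first.
    rewrite -bigcap_seq; apply/seteqP; split=> nu /= h p ps; have := h _ ps; rewrite cdf_repr//.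
    by have [] := sa _ ps.
    by have [] := sa _ ps.
  apply: (big_ind (@open K)) => [|A B|[a [q r]] _ /=]; [exact: openT|exact: openI|].
  have -> : [set mu : K | ratr q < box_cdf mu a < ratr r] = [set mu | `]ratr q,
      ratr r[%classic (box_cdf mu a)].
    by apply/seteqP; split=> mu; rewrite /= in_itv.
  by apply: (@open_cdf a _); exact: interval_open.
rewrite -[X in nbhs X](quotient_projK u) => /truncation_nbhs[[G e] /= [Ga e0] GV].
have /choice[q hq] : forall a, exists q : rat * rat,
    [/\ box_cdf (repr u) a - e < ratr q.1, ratr q.1 < box_cdf (repr u) a,
        box_cdf (repr u) a < ratr q.2 & ratr q.2 < box_cdf (repr u) a + e].
  move=> a; have [|q1] := @rat_in_itvoo R (box_cdf (repr u) a - e) (box_cdf (repr u) a);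
      first by rewrite ltrBlDr ltrDl.
  rewrite in_itv /= => /andP[? ?].
  have [|q2] := @rat_in_itvoo R (box_cdf (repr u) a) (box_cdf (repr u) a + e);
      first by rewrite ltrDl.
  by rewrite in_itv /= => /andP[? ?]; exists (q1, q2).
exists (O [seq (a, q a) | a <- G]).
  split; first by exists [seq (a, q a) | a <- G] => //; apply/all_inP => _ /mapP[a aG ->];
      split=> //; exact: Ga.
  by move=> _ /mapP[a aG ->] /=; have [_ -> ->] := hq a.
move=> v Ov; rewrite -(quotient_projK v); apply: GV => a aG /=.
have /andP[/= l r] := Ov (a, q a) (map_f _ aG); have [h1 h2 h3 h4] := hq a.
rewrite ltr_distlC; apply/andP; split; [exact: lt_trans h1 l|exact: lt_trans r h4].
Qed.

End truncation.

(** * Cofinality *)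

Section cofinality.
Context (R : realType) d (tau : orderType d) (htau : uncountable_regular_cardinal tau)
    (n : nat).
Local Notation T := (closed_ordinal_interval tau).
Local Notation X := (ordinal_cube tau n).
Local Notation K := (radon_probability R X).
Let hX := @ordinal_cube_hausdorff d tau n.

Lemma uniform_exists (s : seq X) : (0 < size s)%N ->
  exists mu : K, forall a, box_cdf mu a = (count (fun y => cle y a) s)%:R / (size s)%:R.
Proof.
move=> s0; have sR : (size s)%:R != 0 :> R by rewrite pnatr_eq0 -lt0n.
pose z (j : 'I_(size s)) := nth (@ctop d tau n) s j.
have [||||mu muE] := @radon_mix R X hX 'I_(size s) (fun=> (size s)%:R^-1) (fun=> setT)
    (fun j => cst (z j)) (radon_dirac R (@ctop d tau n) hX).
- by move=> j; rewrite invr_ge0.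
- by move=> j; exact: clopenT.
- by move=> j; exact: cst_continuous.
- rewrite (eq_bigr (fun=> (size s)%:R^-1)); last by move=> j _; rewrite prT mulr1.
  by rewrite sumr_const card_ord -(mulr_natl (size s)%:R^-1) mulfV.
exists mu => a; rewrite /box_cdf muE; last exact: borel_cle.
rewrite (eq_bigr (fun j => (cle (z j) a)%:R / (size s)%:R)); last first.
  move=> j _; rewrite setTI mulrC; congr (_ * _).
  case: (boolP (cle (z j) a)) => za.
    have -> : (cst (z j) : X -> X) @^-1` [set y | cle y a] = setT; last by rewrite prT.
    by apply/seteqP; split.
  have -> : (cst (z j) : X -> X) @^-1` [set y | cle y a] = set0; last by rewrite pr0.
  by apply/seteqP; split=> y //= h; rewrite h in za.
rewrite -mulr_suml; congr (_ / _).
rewrite -sum1_count [in RHS]big_mkcond /= (big_nth (@ctop d tau n)) big_mkord natr_sum.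
by apply: eq_bigr => j _; rewrite /z; case: (cle _ a).
Qed.

(** The mass of each cell is rounded down to a multiple of [1/N]; the missing mass, at most the
    number of cells over [N], goes to one fixed cell. *)
Lemma uniform_dense (nu : K) (G : seq X) (e : R) : 0 < e -> exists s : seq X, (0 < size s)%N /\
  forall a, a \in G -> `|box_cdf nu a - (count (fun y => cle y a) s)%:R / (size s)%:R| < e.
Proof.
move=> e0; pose p c := pr nu (@cell d tau n G c).
have p0 c : 0 <= p c by exact: pr_ge0.
have psum : \sum_c p c = 1.
  have /(pr_cells htau nu) : depends_on G (setT : set X) by [].
  rewrite prT => ->; apply: eq_bigr => c _; by rewrite indicE in_setT mul1r.
pose m := #|{: (size G).-tuple bool}|.
pose N := (Num.truncn (m%:R / e)).+1.
have N0 : 0 < N%:R :> R by rewrite ltr0n.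
have mN : m%:R / N%:R < e.
  by rewrite ltr_pdivrMr// mulrC -ltr_pdivrMr//; exact: truncnS_gt.
pose k c := Num.truncn (N%:R * p c).
have kle c : (k c)%:R <= N%:R * p c.
  by rewrite truncn_le mulr_ge0// ltW.
have klt c : N%:R * p c < (k c)%:R + 1 by rewrite natr1; exact: truncnS_gt.
have ksum : (\sum_c k c <= N)%N.
  rewrite -(ler_nat R) natr_sum (_ : N%:R = \sum_c N%:R * p c);
      last by rewrite -mulr_sumr psum mulr1.
  by apply: ler_sum => c _; exact: kle.
pose rem := (N - \sum_c k c)%N.
pose c0 := @pattern d tau n G (@ctop d tau n).
pose s := flatten [seq nseq (k c) (cell_rep c) | c <- index_enum ((size G).-tuple bool)] ++
    nseq rem (cell_rep c0).
have cnt (P : pred X) : (count P s)%:R =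
    \sum_c (k c)%:R * (P (cell_rep c))%:R + rem%:R * (P (cell_rep c0))%:R :> R.
  rewrite /s count_cat count_flatten sumnE !big_map natrD natr_sum.
  by congr (_ + _); [apply: eq_bigr => c _|]; rewrite count_nseq mulnC natrM.
have sz : size s = N.
  apply/eqP; rewrite -(eqr_nat R) -count_predT cnt /= mulr1.
  under eq_bigr do rewrite mulr1.
  by rewrite -natr_sum -natrD subnKC.
exists s; split; first by rewrite sz.
move=> a aG; rewrite cnt sz.
have -> : box_cdf nu a = \sum_c (cle (cell_rep c) a)%:R * p c.
  rewrite /box_cdf (@pr_cells R d tau htau n G) => [|y z yz /=]; last by rewrite yz.
  apply: eq_bigr => c _; congr (_ * _); rewrite indicE; congr ((nat_of_bool _)%:R).
  by apply/idP/idP; rewrite inE.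
pose P (c : (size G).-tuple bool) : R := (cle (cell_rep c) a)%:R.
pose Q : R := (cle (cell_rep c0) a)%:R.
have P01 c : 0 <= P c <= 1 by rewrite /P; case: (cle _ _); rewrite ?lexx ?ler01.
have remE : rem%:R = \sum_c (N%:R * p c - (k c)%:R).
  by rewrite sumrB -mulr_sumr psum mulr1 natrB// natr_sum.
have remle : rem%:R <= m%:R :> R.
  rewrite remE /m -sum1_card natr_sum; apply: ler_sum => c _.
  by rewrite lerBlDl ltW// addrC.
(* Multiplied by [N], the error is a difference of two quantities that both lie between 0 and
   [rem]. *)
have AE : \sum_c P c * p c - (\sum_c (k c)%:R * P c + rem%:R * Q) / N%:R =
   (\sum_c (N%:R * p c - (k c)%:R) * P c - rem%:R * Q) / N%:R.
  apply: (mulIf (lt0r_neq0 N0)); rewrite mulrBl !mulfVK ?lt0r_neq0//.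
  under [X in _ = X - _]eq_bigr do rewrite mulrBl.
  rewrite sumrB opprD addrA; congr (_ - _ - _); rewrite mulr_suml.
  by apply: eq_bigr => c _; rewrite mulrC mulrA mulrAC.
suff : `|\sum_c P c * p c - (\sum_c (k c)%:R * P c + rem%:R * Q) / N%:R| < e by [].
rewrite AE normrM normfV (gtr0_norm N0).
apply: le_lt_trans mN; rewrite ler_pM2r ?invr_gt0//; apply: le_trans remle.
have A0 : 0 <= \sum_c (N%:R * p c - (k c)%:R) * P c.
  by apply: sumr_ge0 => c _; rewrite mulr_ge0 ?subr_ge0//; case/andP: (P01 c).
have A1 : \sum_c (N%:R * p c - (k c)%:R) * P c <= rem%:R.
  rewrite remE; apply: ler_sum => c _; rewrite ler_piMr ?subr_ge0//.
  by case/andP: (P01 c).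
have Q0 : 0 <= rem%:R * Q by rewrite mulr_ge0// /Q; case: (cle _ _).
have Q1 : rem%:R * Q <= rem%:R.
  by rewrite ler_piMr// /Q; case: (cle _ _).
rewrite ler_norml; apply/andP; split; lra.
Qed.

Lemma grid_cover (G : seq X) : exists b, forall a, a \in G -> grid b a.
Proof.
have [a0 _] := tau_inhabited htau.
have [b hb] := bounding_countable htau (countableP [set: nat * 'I_n])
  (fun p => odflt a0 (nth (@ctop d tau n) G p.1 p.2)).
exists b => a aG i; have := hb (index a G, i) I; rewrite /= nth_index// /below.
by case: (a i).
Qed.

Lemma grid_finite m (G : seq X) : limit_ordinal m -> (forall a, a \in G -> grid m a) ->
  exists2 c, (c < m)%O & forall a, a \in G -> grid c a.
Proof.
move=> [[b bm] lim] Gm.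
have [|c [bc cm cP]] := @finite_bound _ tau _ [seq (a, i) | a <- G,
    i <- enum 'I_n] b m (fun p => p.1 p.2 : option tau) bm.
  move=> [a i] t /allpairsP[[a' i'] /= [aG _ [-> ->]]] E.
  by have := Gm _ aG i'; rewrite /below E.
(* [c] bounds the coordinates only weakly whereas grids are strict, so one more step below the limit
   is taken. *)
have [c' cc' c'm] := lim c cm; exists c' => // a aG i.
rewrite /below; case E : (a i) => [t|//]; apply: le_lt_trans cc'.
by apply: (cP (a, i)) E; apply/allpairsP; exists (a, i); rewrite mem_enum.
Qed.

Lemma hausdorff_eq (Y : topologicalType) (u v : Y) : hausdorff_space Y ->
  (forall A, nbhs u A -> A v) -> u = v.
Proof. by move=> hY h; apply: hY => A B uA vB; exists v; split;
    [exact: h|exact: nbhs_singleton]. Qed.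

Lemma quotient_nbhs (L : equiv_rel K) (mu : K) A : nbhs (quotient_proj L mu) A ->
  cdf_nbhs setT mu (quotient_proj L @^-1` A).
Proof.
by move=> h; rewrite -radon_nbhsE//; exact: (@quotient_proj_continuous K L mu A h).
Qed.

(** A basic neighbourhood of the class of [mu] contains the classes of all measures sharing finitely
    many box masses with [mu]; regularity bounds these corners over the whole base, and the
    Hausdorff property concludes. *)
Lemma locally_determined (L : equiv_rel K) (mu : K) : small_quotients tau L ->
  exists b, forall nu : K, (forall a, grid b a -> box_cdf mu a = box_cdf nu a) ->
    quotient_proj L mu = quotient_proj L nu.
Proof.
move=> [hL [Bs [Bo Bb] /(card_lt_bounding htau) Blt]].
have /choice[g hg] : forall U, exists b, nbhs (quotient_proj L mu) U ->
    forall nu : K, (forall a, grid b a -> box_cdf mu a = box_cdf nu a) ->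
        U (quotient_proj L nu).
  move=> U; have [a0 _] := tau_inhabited htau.
  have [nU|] := pselect (nbhs (quotient_proj L mu) U); last by exists a0.
  have [[G e] [_ /= e0] GU] := quotient_nbhs nU.
  have [b hb] := grid_cover G; exists b => _ nu h; apply: GU => a aG.
  by rewrite h ?subrr ?normr0//; exact: hb.
have [b hb] := Blt g; exists b => nu h; apply: hausdorff_eq => // A nA.
have [U [BU Uu] UA] := Bb _ _ nA; apply: UA.
apply: (hg U) => [|a ga]; first by apply: open_nbhs_nbhs; split=> //; exact: Bo.
by apply: h; apply: grid_le ga; exact/ltW/hb.
Qed.

(** Coordinates of [y] at or above [m] exceed every coordinate of a grid corner other than the
    endpoint, so raising them changes no comparison. *)
Lemma cle_collapse m (y a : X) : grid m a -> cle (collapse m y) a = cle y a.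
Proof.
move=> ga; apply: eq_forallb => i; have := ga i; rewrite /collapse.
case: (y i) (a i) => [t|] [u|] //= um; case: ifP => [//|/negbT].
- rewrite -leNgt some_le => mt; apply/esym/negbTE; rewrite -ltNge.
  exact: lt_le_trans um mt.
- by rewrite !le_right_end.
Qed.

(* With [p] the projection onto [L], the set of [nu] such that
   [p nu = p (truncate m nu)] is closed and contains the uniform measures on finite
   sequences. *)
Lemma truncation_cofinal a0 (L : equiv_rel K) : small_quotients tau L ->
  exists m, [/\ (a0 < m)%O, limit_ordinal m & quotient_le L (truncation R n m)].
Proof.
move=> sL; have hL : hausdorff_space (quotient_space L) by case: sL.
have /choice[um hum] : forall s : seq X, exists mu : K, (0 < size s)%N ->
    forall a, box_cdf mu a = (count (fun y => cle y a) s)%:R / (size s)%:R.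
  move=> s; case: (posnP (size s)) => [s0|/uniform_exists[mu muE]]; last by exists mu.
  by exists (radon_dirac R (@ctop d tau n) hX); rewrite s0.
have /choice[g hg] := fun s => locally_determined (um s) sL.
(* [gc c] bounds [g] on all sequences from [grid c] at once. At a closure point [m] of [gc] this
   bounds [g] on sequences from [grid m], since each of them lies in a smaller grid. *)
have /choice[gc hgc] : forall c, exists b, forall s, all_in (grid c) s -> (g s < b)%O.
  by move=> c; have [b hb] := bounding_seq htau (bounding_grid htau (n := n) c) g; exists b.
have [m [am lm mcl]] := limit_closure htau a0 gc.
exists m; split=> //.
have gm s : all_in (grid m) s -> (g s <= m)%O.
  move=> /all_inP /(grid_finite lm)[c0 c0m sc0].
  have [c c0c [cm gcm]] := mcl _ c0m; apply: le_trans gcm; apply/ltW/hgc/all_inP => a /sc0.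
  exact/grid_le/ltW.
(* It suffices that any two neighbourhoods of the two classes meet: the class of a uniform measure
   close enough to [nu] at all relevant corners lies in both. *)
have trunc nu : quotient_proj L nu = quotient_proj L (truncate htau m nu).
  apply: hL => A1 A2 /quotient_nbhs[[G1 e1] [_ /= e10] GA1] /quotient_nbhs[[G2 e2] [_ /=
      e20] GA2].
  have e0 : 0 < Num.min e1 e2 by rewrite lt_min e10.
  have [s [s0 hs]] := uniform_dense nu (G1 ++ [seq collapse m a | a <- G2]) e0.
  have umE := hum s s0.
  pose s' := [seq collapse m y | y <- s].
  have s'0 : (0 < size s')%N by rewrite size_map.
  have s'm : all_in (grid m) s' by apply/all_inP => _ /mapP[y _ ->]; exact: grid_collapse.
  have s'E a : grid m a -> box_cdf (um s') a = box_cdf (um s) a.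
    move=> ga; rewrite umE hum// size_map count_map; congr (_%:R / _).
    by apply: eq_count => y /=; exact: cle_collapse.
  have e1' : quotient_proj L (um s') = quotient_proj L (um s).
    by apply: hg => a ga; apply: s'E; apply: grid_le ga; exact: gm.
  have e2' : quotient_proj L (um s') = quotient_proj L (truncate htau m (um s)).
    apply: hg => a ga; have gma : grid m a by apply: grid_le ga; exact: gm.
    by rewrite cdf_truncate collapse_id// s'E.
  exists (quotient_proj L (um s)); split.
    apply: GA1 => a aG; rewrite umE; have := hs a; rewrite mem_cat aG lt_min.
    by move=> /(_ isT)/andP[].
  rewrite -e1' e2'; apply: GA2 => a aG; rewrite !cdf_truncate umE.
  have := hs (collapse m a); rewrite mem_cat map_f// orbT lt_min.
  by move=> /(_ isT)/andP[].
apply/quotient_leP => mu nu /truncationP mn; apply/quotient_projP.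
rewrite trunc [RHS]trunc; apply: hausdorff_eq => // A /quotient_nbhs[[G e] [_ /= e0] GA].
apply: GA => a _; rewrite !cdf_truncate mn ?subrr ?normr0//; exact: grid_collapse.
Qed.

(** * The semilattice of truncations *)

Variable x : X.

(** The second condition makes [x] itself a corner of the grid. *)
Definition good_ordinal (al : tau) :=
  limit_ordinal al /\ forall i b, x i = Some b -> (b < al)%O.

Definition truncations : set (equiv_rel K) :=
  [set L | exists2 al, good_ordinal al & L = truncation R n al].

Lemma truncations_small : truncations `<=` @small_quotients tau K.
Proof.
by move=> _ [al _ ->]; split; [exact: truncation_hausdorff|exact: truncation_weight].
Qed.

Lemma truncations_cofinal : @cofinal_quotients tau K truncations.
Proof.
move=> L sL; have [a0 xa0] := grid_cover [:: x].
have [m [am lm Lm]] := truncation_cofinal a0 sL.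
exists (truncation R n m) => //; exists m => //; split=> // i b xib.
by apply: lt_trans am; have := xa0 x (mem_head _ _) i; rewrite /below xib.
Qed.

Lemma truncation_le (al be : tau) : (al <= be)%O -> quotient_le (truncation R n al)
    (truncation R n be).
Proof.
move=> ab; apply/quotient_leP => mu nu /truncationP h; apply/truncationP => a ga.
by apply: h; exact: grid_le ga.
Qed.

(** The ordinals of the given truncations have a supremum [m] below [tau], again a limit. Any corner
    of [grid m] already lies in the grid of a member of [F], so truncation at [m] is the least upper
    bound. *)
Lemma truncations_semilattice : @tau_semilattice tau K truncations.
Proof.
move=> F FS [L0 FL0] /(card_lt_bounding htau) bF.
have [t0 _] := tau_inhabited htau.
have /choice[al hal] : forall L, exists a, F L -> good_ordinal a /\ L = truncation R n a.
  move=> L; have [/FS[a ga ->]|] := pselect (F L); last by exists t0.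
  by exists a.
have [b0 hb0] := bF al.
have [||m [um ml]] := @exists_lub _ tau htau (al @` F) b0.
- by exists (al L0); exists L0.
- by move=> _ [L FL <-]; exact: hb0.
have gm : good_ordinal m.
  have [[[b bal] _] xal] := (hal _ FL0).1.
  have alm : (al L0 <= m)%O by apply: um; exists L0.
  split; last by move=> i c /xal cal; exact: lt_le_trans alm.
  split; first by exists b; exact: lt_le_trans alm.
  move=> c /ml[_ [L FL <-] cL].
  have [[[_ lim] _] _] := hal _ FL; have [e ce eL] := lim _ cL.
  by exists e => //; apply: lt_le_trans eL _; apply: um; exists L.
exists (truncation R n m); first by exists m.
split; first by apply: truncations_small; exists m.
  move=> L FL; have [_ ->] := hal _ FL.
  by apply: truncation_le; apply: um; exists L.
move=> N _ FN; apply/quotient_leP => mu nu mn; apply/truncationP => a ga.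
have [|c cm ca] := @grid_finite m [:: a] gm.1; first by move=> b; rewrite inE => /eqP ->.
have [_ [L FL <-] cL] := ml _ cm.
have /quotient_leP/(_ _ _ mn) := FN _ FL; have [_ ->] := hal _ FL.
move=> /truncationP; apply; apply: grid_le (ltW cL) _ _; apply: ca; exact: mem_head.
Qed.

End cofinality.

(** * The transport problem *)

Section transport.
Context (R : realFieldType) (T U : finType) (e : T -> U -> bool).
Implicit Types (t : T -> R) (s : U -> R) (Y Z : {set T}).

Definition neighbours Y : {set U} := [set u | [exists y in Y, e y u]]%SET.

Definition hall t s := [/\ forall x, 0 <= t x, forall u, 0 <= s u,
  \sum_x t x = \sum_u s u &
  forall Y, \sum_(x in Y) t x <= \sum_(u in neighbours Y) s u].

Definition coupled t s := exists w : T -> U -> R, [/\ forall x u, 0 <= w x u,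
  forall x u, w x u != 0 -> e x u, forall x, \sum_u w x u = t x &
  forall u, \sum_x w x u = s u].

Lemma neighboursU Y Z : neighbours (Y :|: Z) = neighbours Y :|: neighbours Z.
Proof.
apply/finset.setP => u; rewrite !inE; apply/existsP/orP.
  by case=> y /andP[]; rewrite inE => /orP[yY|yZ] yu; [left|right]; apply/existsP; exists y;
      apply/andP.
by case=> /existsP[y /andP[yY yu]]; exists y; rewrite inE yY ?orbT.
Qed.

Lemma neighbours_sub Y Z : Y \subset Z -> neighbours Y \subset neighbours Z.
Proof.
move=> /fintype.subsetP YZ; apply/fintype.subsetP => u;
    rewrite !inE => /existsP[y /andP[yY yu]].
by apply/existsP; exists y; rewrite YZ.
Qed.

Lemma sum_subset (I : finType) (f : I -> R) (Y Z : {set I}) : (forall i, 0 <= f i) ->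
  Y \subset Z -> \sum_(i in Y) f i <= \sum_(i in Z) f i.
Proof.
move=> f0 YZ; rewrite [leRHS](big_setID Y) /=.
by rewrite (finset.setIidPr YZ) lerDl sumr_ge0.
Qed.

Lemma sum_restrict (I : finType) (f : I -> R) (Y Z : {set I}) :
  \sum_(i in Z) (if i \in Y then f i else 0) = \sum_(i in Z :&: Y) f i.
Proof.
by rewrite -big_mkcondr /=; apply: eq_bigl => i; rewrite inE.
Qed.

(** Neighbours of a subset of [Y] lie among the neighbours of [Y], and tightness balances the
    totals. *)
Lemma hall_restrict t s Y : hall t s ->
  \sum_(x in Y) t x = \sum_(u in neighbours Y) s u ->
  hall (fun x => if x \in Y then t x else 0) (fun u => if u \in neighbours Y then s u else 0).
Proof.
move=> [t0 s0 ts H] tight; split=> [x|u||Z]; [by case: ifP|by case: ifP| |].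
  by rewrite -!big_mkcond.
rewrite !sum_restrict; apply: le_trans (H _) _; apply: sum_subset => //.
by rewrite finset.subsetI !neighbours_sub// ?finset.subsetIl ?finset.subsetIr.
Qed.

(** Hall's inequality for the union of [Z] and [Y], minus the equality for the tight set [Y], is the
    inequality on the complement. *)
Lemma hall_corestrict t s Y : hall t s ->
  \sum_(x in Y) t x = \sum_(u in neighbours Y) s u ->
  hall (fun x => if x \in ~: Y then t x else 0) (fun u =>
      if u \in ~: neighbours Y then s u else 0).
Proof.
move=> [t0 s0 ts H] tight; split=> [x|u||Z]; [by case: ifP|by case: ifP| |].
  rewrite -!big_mkcond /=; apply: (addrI (\sum_(x in Y) t x)); rewrite {2}tight.
  transitivity (\sum_x t x); last rewrite ts.
    by rewrite [RHS](bigID (mem Y)) /=; congr (_ + _); apply: eq_bigl => x; rewrite inE.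
  by rewrite [LHS](bigID (mem (neighbours Y))) /=; congr (_ + _); apply: eq_bigl => x;
      rewrite finset.in_setC.
rewrite !sum_restrict -!finset.setDE.
have := H (Z :|: Y); rewrite neighboursU.
rewrite (big_setID Y) /= [leRHS](big_setID (neighbours Y)) /=.
by rewrite !finset.setDUl !finset.setDv !finset.setU0 !(finset.setIidPr (finset.subsetUr _
    _)) tight lerD2l.
Qed.

Lemma coupledD t1 s1 t2 s2 : coupled t1 s1 -> coupled t2 s2 ->
  coupled (fun x => t1 x + t2 x) (fun u => s1 u + s2 u).
Proof.
move=> [w1 [p1 e1 r1 c1]] [w2 [p2 e2 r2 c2]]; exists (fun x u => w1 x u + w2 x u); split.
- by move=> x u; rewrite addr_ge0.
- move=> x u h; case: (eqVneq (w1 x u) 0) => [z1|/e1//].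
  by apply: e2; move: h; rewrite z1 add0r.
- by move=> x; rewrite big_split /= r1 r2.
- by move=> u; rewrite big_split /= c1 c2.
Qed.

Lemma coupled_ext t s t' s' : t =1 t' -> s =1 s' -> coupled t s -> coupled t' s'.
Proof.
by move=> tt' ss' [w [w0 we wr wc]]; exists w; split=> // ?; rewrite ?wr ?wc.
Qed.

Lemma sum_indicator (I : finType) (a : R) (i0 : I) (Y : {set I}) :
  \sum_(i in Y) (if i == i0 then a else 0) = if i0 \in Y then a else 0.
Proof.
case: ifP => iY.
  rewrite (bigD1 i0) //= eqxx big1 ?addr0// => i /andP[_ /negbTE ->] //.
by rewrite big1 // => i iY'; case: eqP => // E; rewrite -E iY' in iY.
Qed.

Lemma sum_indicatorT (I : finType) (a : R) (i0 : I) :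
  \sum_i (if i == i0 then a else 0) = a.
Proof. by rewrite -big_mkcond /= big_pred1_eq. Qed.

Lemma coupled_point a x0 u0 : 0 <= a -> e x0 u0 ->
  coupled (fun x => if x == x0 then a else 0) (fun u => if u == u0 then a else 0).
Proof.
move=> a0 exu; exists (fun x u => if (x == x0) && (u == u0) then a else 0); split.
- by move=> x u; case: ifP.
- by move=> x u; case: ifP => [/andP[/eqP -> /eqP ->]|]; rewrite ?eqxx.
- by move=> x; case: (x == x0) => /=; [rewrite sum_indicatorT|rewrite big1].
- move=> u; case: (u == u0) => /=; last by rewrite big1 // => x _; rewrite andbF.
  by under eq_bigr do rewrite andbT; rewrite sum_indicatorT.
Qed.

(* Move the largest admissible mass along one edge: either a support shrinks,
   or some set becomes tight and the problem splits. *)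
Lemma hall_coupled t s : hall t s -> coupled t s.
Proof.
have [m] := ubnP (#|[set x | t x != 0%R]%SET| + #|[set u | s u != 0%R]%SET|)%N.
elim: m t s => // m IH t s mts Hts; have [t0 s0 ts H] := Hts.
have [/existsP[x0 tx0]|/existsPn tz] := boolP [exists x, t x != 0]; last first.
  have {}tz x : t x = 0 by apply/eqP/negPn/tz.
  have sz u : s u = 0.
    have /eqP : \sum_u s u = 0 by rewrite -ts big1.
    by rewrite psumr_eq0 => [/allP/(_ u (mem_index_enum _))/eqP|v _]; rewrite ?s0.
  by exists (fun _ _ => 0); split=> [//|x u|x|u]; rewrite ?eqxx ?big1 ?tz ?sz.
have tx0' : 0 < t x0 by rewrite lt0r tx0 t0.
(* Hall's inequality for [x0] alone forces a neighbour of positive weight. *)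
have [u0 exu su0] : exists2 u0, e x0 u0 & 0 < s u0.
  apply: contrapT => h; have := H [set x0]%SET; rewrite big_set1 leNgt => /negP; apply.
  rewrite big1 // => u; rewrite inE => /existsP[y /andP[]]; rewrite inE => /eqP -> eu.
  by apply/eqP; rewrite eq_le s0 andbT leNgt; apply/negP => su; apply: h; exists u.
pose slack (Y : {set T}) := \sum_(u in neighbours Y) s u - \sum_(x in Y) t x.
(* These are the sets whose slack decreases when mass is moved along the edge: if [x0] belongs to
   the set, both sides of Hall's inequality drop together. *)
pose adm (Y : {set T}) := (x0 \notin Y) && (u0 \in neighbours Y).
pose t' a x := t x - (if x == x0 then a else 0).
pose s' a u := s u - (if u == u0 then a else 0).
have st' a Y : \sum_(x in Y) t' a x = \sum_(x in Y) t x - (if x0 \in Y then a else 0).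
  by rewrite sumrB sum_indicator.
have ss' a (Y : {set U}) : \sum_(u in Y) s' a u =
    \sum_(u in Y) s u - (if u0 \in Y then a else 0).
  by rewrite sumrB sum_indicator.
have hall' a : a <= t x0 -> a <= s u0 -> (forall Y, adm Y -> a <= slack Y) -> 0 <= a ->
    hall (t' a) (s' a).
  move=> at_ as_ asl a0; split.
  - by move=> x; rewrite /t'; case: eqP => [->|]; rewrite ?subr0 ?subr_ge0.
  - by move=> u; rewrite /s'; case: eqP => [->|]; rewrite ?subr0 ?subr_ge0.
  - by rewrite !sumrB !sum_indicatorT ts.
  - move=> Y; rewrite st' ss'; have := asl Y; rewrite /adm /slack; have := H Y.
    have xu : x0 \in Y -> u0 \in neighbours Y.
      by move=> xY; rewrite inE; apply/existsP; exists x0; rewrite xY.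
    case: (x0 \in Y) xu => [/(_ isT) ->|_] /=; first by rewrite lerD2r.
    case: (u0 \in neighbours Y) => /= h; last by rewrite !subr0.
    by move=> /(_ isT); rewrite subr0 lerBrDl lerBrDr addrC.
have back a : 0 <= a -> coupled (t' a) (s' a) -> coupled t s.
  move=> a0 c; apply: coupled_ext (coupledD c (coupled_point a0 exu)) => x.
    by rewrite /t' subrK.
  by rewrite /s' subrK.
have supps a u : s' a u != 0 -> s u != 0.
  by rewrite /s'; case: (u =P u0) => [-> _|_]; [exact: lt0r_neq0|rewrite subr0].
have suppt' a : [set x | t' a x != 0]%SET \subset [set x | t x != 0]%SET.
  apply/fintype.subsetP => x; rewrite !inE /t'; case: (x =P x0) => [->//|_].
  by rewrite subr0.
have supps' a : [set u | s' a u != 0]%SET \subset [set u | s u != 0]%SET.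
  by apply/fintype.subsetP => u; rewrite !inE; exact: supps.
have smaller (f : T -> R) (g : U -> R) :
    [set x | f x != 0]%SET \subset [set x | t x != 0]%SET ->
    [set u | g u != 0]%SET \subset [set u | s u != 0]%SET ->
    f x0 = 0 \/ g u0 = 0 ->
    (#|[set x | f x != 0%R]%SET| + #|[set u | g u != 0%R]%SET| < m)%N.
  move=> ft gs fg; rewrite -ltnS; apply: leq_trans mts; rewrite ltnS.
  case: fg => [fx|gu].
    have lt : (#|[set x | f x != 0%R]%SET| < #|[set x | t x != 0%R]%SET|)%N.
      apply: proper_card; rewrite properE ft /=; apply/negP => /fintype.subsetP/(_ x0).
      by rewrite !inE fx eqxx => /(_ tx0).
    by apply: leq_trans (leq_add lt (subset_leq_card gs)).
  have lt : (#|[set u | g u != 0%R]%SET| < #|[set u | s u != 0%R]%SET|)%N.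
    apply: proper_card; rewrite properE gs /=; apply/negP => /fintype.subsetP/(_ u0).
    by rewrite !inE gu eqxx => /(_ (lt0r_neq0 su0)).
  by rewrite -addnS; apply: leq_add (subset_leq_card ft) lt.
pose a0 := Num.min (t x0) (s u0).
have a00 : 0 <= a0 by rewrite le_min !t0 s0.
have [/forallP asl|/forallPn[Y1]] := boolP [forall Y, adm Y ==> (a0 <= slack Y)].
  apply: (back a0) => //; apply: IH; last first.
    by apply: hall'; rewrite // ?/a0 ?ge_min ?lexx ?orbT// => Y aY; have := asl Y; rewrite aY.
  apply: smaller => //; rewrite /t' /s' !eqxx /a0.
  by case: leP => _; [left|right]; rewrite subrr.
rewrite negb_imply -ltNge => /andP[aY1 lt1].
(* Moving the least slack makes this [Y] tight. It omits [x0] and has [u0] as a neighbour, so each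
   half of the split loses a support point. *)
case: (arg_minP slack aY1) => Y aY Ymin.
have ltY : slack Y < a0 by apply: le_lt_trans lt1; exact: Ymin.
have sl0 : 0 <= slack Y by rewrite subr_ge0.
have Hs : hall (t' (slack Y)) (s' (slack Y)).
  by move: ltY; rewrite lt_min => /andP[/ltW l1 /ltW l2]; apply: hall'.
have /andP[xY uY] := aY.
have tight : \sum_(x in Y) t' (slack Y) x = \sum_(u in neighbours Y) s' (slack Y) u.
  by rewrite st' ss' (negbTE xY) uY /slack subr0 opprB addrC subrK.
apply: (back (slack Y)) => //.
have c1 : coupled (fun x => if x \in Y then t' (slack Y) x else 0)
    (fun u => if u \in neighbours Y then s' (slack Y) u else 0).
  apply: IH; last exact: hall_restrict.
  apply: smaller; last by left; rewrite (negbTE xY).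
    apply: fintype.subset_trans (suppt' (slack Y)); apply/fintype.subsetP => x; rewrite !inE.
    by case: ifP; rewrite ?eqxx.
  apply: fintype.subset_trans (supps' (slack Y)); apply/fintype.subsetP => x; rewrite !inE.
  by case: ifP; rewrite ?eqxx.
have c2 : coupled (fun x => if x \in ~: Y then t' (slack Y) x else 0)
    (fun u => if u \in ~: neighbours Y then s' (slack Y) u else 0).
  apply: IH; last exact: hall_corestrict.
  apply: smaller; last by right; rewrite finset.in_setC uY.
    apply: fintype.subset_trans (suppt' (slack Y)); apply/fintype.subsetP => x; rewrite !inE.
    by case: ifP; rewrite ?eqxx.
  apply: fintype.subset_trans (supps' (slack Y)); apply/fintype.subsetP => x; rewrite !inE.
  by case: ifP; rewrite ?eqxx.
apply: coupled_ext (coupledD c1 c2) => [x|u]; rewrite finset.in_setC.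
  by case: (x \in Y); rewrite /= ?addr0 ?add0r.
by case: (u \in neighbours Y); rewrite /= ?addr0 ?add0r.
Qed.

(** The conditional law of the coupling given [u]; where [s u] vanishes it is set to the point mass
    at [x0]. *)
Lemma hall_kernel (x0 : T) t s : hall t s -> exists kappa : U -> T -> R,
  [/\ forall u x, 0 <= kappa u x, forall u, \sum_x kappa u x = 1,
      forall x, \sum_u s u * kappa u x = t x &
      forall u x, s u * kappa u x != 0 -> e x u].
Proof.
move=> Hts; have [t0 s0 _ _] := Hts; have [w [w0 we wr wc]] := hall_coupled Hts.
exists (fun u x => if s u == 0 then (x == x0)%:R else w x u / s u).
have swE u x : s u * (if s u == 0 then (x == x0)%:R else w x u / s u) = w x u.
  case: eqVneq => su; last by rewrite mulrC divfK.
  rewrite su mul0r; have := wc u; rewrite su => /eqP.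
  by rewrite psumr_eq0 => [/allP/(_ x (mem_index_enum _))/eqP|v _]; rewrite ?w0.
split.
- by move=> u x; case: eqP => // _; rewrite divr_ge0.
- move=> u; case: eqVneq => su; last by rewrite -mulr_suml wc mulfV.
  rewrite (bigD1 x0) //= eqxx big1 ?addr0// => x /negbTE -> //.
- by move=> x; under eq_bigr do rewrite swE; exact: wr.
- by move=> u x; rewrite swE; exact: we.
Qed.

End transport.

(** * Fibre orders *)

Lemma antisymmetrization_isomorphic d1 (T : preorderType d1) d2 (O : porderType d2)
    (phi : T -> O) :
  (forall s t, (s <= t)%O = (phi s <= phi t)%O) -> (forall o, exists s, phi s = o) ->
  order_isomorphic (antisymmetrization T) O.
Proof.
move=> phi_le /choice[g gK].
pose Q := {eq_quot (@preorder_equiv_rel _ T)}%qT.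
exists (fun a : antisymmetrization T => phi (repr (a : Q))); last first.
  by move=> a b; rewrite -phi_le.
exists (fun o => (\pi_Q (g o))%qT : antisymmetrization T) => [a|o].
  rewrite -[RHS](@reprK _ Q); apply/(@eqmodP _ (@preorder_equiv_rel _ T)).
  by apply/andP; rewrite !phi_le gK.
apply: le_anti; rewrite -{2}(gK o) -{3}(gK o) -!phi_le.
have /(@eqmodP _ (@preorder_equiv_rel _ T))/andP[h1 h2] := @reprK _ Q (\pi_Q (g o))%qT.
by rewrite h1 h2.
Qed.

Section fibre.
Context (R : realType) d (tau : orderType d) (htau : uncountable_regular_cardinal tau)
    (n : nat).
Local Notation T := (closed_ordinal_interval tau).
Local Notation X := (ordinal_cube tau n).
Local Notation K := (radon_probability R X).
Let hX := @ordinal_cube_hausdorff d tau n.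
Context (x : X) (al be : tau) (gal : good_ordinal x al) (albe : (al < be)%O).
Context (k : nat) (e : 'I_k -> 'I_n) (e_inj : injective e).
Hypothesis e_range : forall i, x i = right_end <-> exists j, e j = i.

Lemma cdf_span_eq (E : set X) (phi : K -> R) mu nu : cdf_span E phi ->
  (forall a, E a -> box_cdf mu a = box_cdf nu a) -> phi mu = phi nu.
Proof.
move=> [s [sE h]] mn; rewrite !h !big_seq; apply: eq_bigr => p ps.
by rewrite mn//; exact: sE.
Qed.

Definition above (c : tau) (y : X) : {set 'I_k} := [set j | (Some c : T) < y (e j)]%O%SET.

Definition coord_box (i : 'I_n) (c : T) : X := fun i' => if i' == i then c else right_end.

Lemma cle_coord_box y i c : cle y (coord_box i c) = ((y i : T) <= c)%O.
Proof.
apply/cleP/idP => [/(_ i)|h i']; rewrite /coord_box ?eqxx//.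
by case: eqP => [->//|_]; exact: le_right_end.
Qed.

Lemma grid_coord_box c i (t : T) : below c t -> grid c (coord_box i t).
Proof. by move=> ct i'; rewrite /coord_box; case: ifP. Qed.

Definition above_boxes c : seq X := [seq coord_box (e j) (Some c) | j <- enum 'I_k].

Lemma above_depends c (P : pred {set 'I_k}) : depends_on (above_boxes c) [set y | P
    (above c y)].
Proof.
move=> y z yz /=; suff -> : above c y = above c z by [].
apply/finset.setP => j; rewrite !finset.inE !ltNge -!cle_coord_box yz//.
by apply/mapP; exists j; rewrite ?mem_enum.
Qed.

Lemma above_boxes_grid c c' : (c < c')%O -> forall a, a \in above_boxes c -> grid c' a.
Proof. by move=> cc' _ /mapP[j _ ->]; exact: grid_coord_box. Qed.

Lemma above_borel c (P : pred {set 'I_k}) : borel [set y | P (above c y)].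
Proof. exact: clopen_borel (depends_on_clopen htau (above_depends (P := P))). Qed.

Lemma above_span c c' (P : pred {set 'I_k}) : (c < c')%O ->
  cdf_span (grid c') (fun mu : K => pr mu [set y | P (above c y)]).
Proof.
move=> cc'; apply: cdf_span_pr (above_depends (P := P)) => //.
- exact: grid_min.
- exact: above_boxes_grid.
Qed.

(* The image of [mu] in the simplex P_k of the theorem. *)
Definition mass (mu : K) (B : {set 'I_k}) : R := pr mu [set y | above al y = B].

Lemma pr_above (mu : K) (P : pred {set 'I_k}) : pr mu [set y | P
    (above al y)] = \sum_(B | P B) mass mu B.
Proof.
have := @pr_partition R X _ (above al) mu setT P; rewrite setIT => ->.
- by apply: eq_bigr => B _; rewrite setIT.
- exact: (@measurableT _ (g_sigma_algebraType (@open X))).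
- move=> B; have := @above_borel al (pred1 B).
  by congr borel; apply/seteqP; split=> y /eqP.
Qed.

Lemma mass_span B : cdf_span (grid be) (fun mu : K => mass mu B).
Proof.
have := above_span (pred1 B) albe; congr cdf_span; apply/funext => mu; congr pr.
by apply/seteqP; split=> y /eqP.
Qed.

(** The fibre preorder carried over to representatives, as [fiber_leE] shows; agreement on [grid al]
    stands for equal images in the coarser quotient. *)
Definition fibre_le (mu nu : K) := forall U, cdf_nbhs (grid be) mu U ->
  exists2 V, cdf_nbhs (grid be) nu V & forall nu', V nu' ->
    exists2 mu', U mu' & forall a, grid al a -> box_cdf mu' a = box_cdf nu' a.

(* A small move in the weak* topology when [c < al] is close to [al], after which
   [above c] is the former [above al]. *)
Definition squeeze (c : tau) (y : X) : X :=
  fun i => if ((Some c : T) < y i <= (Some al : T))%O then Some c else y i.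

(** The preimage of a closed lower ray is again one, with bounds in [[c, al)] raised to [al]. Hence
    [squeeze c] is continuous and preserves every box whose corner has no coordinate in
    [[c, al)]. *)
Lemma squeeze_le c (t u : T) : (c < al)%O ->
  ((if ((Some c : T) < t <= (Some al : T))%O then (Some c : T) else t) <= u)%O =
  (t <= if ((Some c : T) <= u < (Some al : T))%O then (Some al : T) else u)%O.
Proof.
move=> cal; have cal' : ((Some c : T) < Some al)%O by rewrite some_lt.
case: ifPn => [/andP[ct ta]|].
  case: (leP (Some c : T) u) => cu /=.
    by case: ltP => [_|au]; rewrite ?ta ?(le_trans ta au).
  by apply/esym/negbTE; rewrite -ltNge; exact: lt_trans ct.
rewrite negb_and -leNgt -ltNge => h; case: ifP => // /andP[cu ua].
case/orP: h => h; first by rewrite (le_trans h cu) (le_trans h (ltW cal')).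
apply/idP/idP => [tu|ta]; first by have := lt_le_trans (lt_trans ua h) tu; rewrite ltxx.
by have := lt_le_trans h ta; rewrite ltxx.
Qed.

Lemma squeeze_continuous c : (c < al)%O -> continuous (squeeze c).
Proof.
move=> cal; apply: cube_continuous => i u.
have -> : [set y | (squeeze c y i <= u :> T)%O] =
   [set y : X | (y i <= if ((Some c : T) <= u < (Some al : T))%O then (Some al : T) else u)%O].
  by apply/seteqP; split=> y /=; rewrite /squeeze squeeze_le.
exact: clopen_coord.
Qed.

Lemma above_squeeze c y : (c < al)%O -> above c (squeeze c y) = above al y.
Proof.
move=> cal; have cal' : ((Some c : T) < Some al)%O by rewrite some_lt.
apply/finset.setP => j; rewrite !finset.inE /squeeze.
case: ifPn => [/andP[_ ya]|]; first by rewrite ltxx ltNge ya.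
rewrite negb_and -leNgt -ltNge => /orP[yc|ay]; last by rewrite ay (lt_trans cal' ay).
by rewrite !ltNge yc (le_trans yc (ltW cal')).
Qed.

Lemma above_le c y : (c < al)%O -> above al y \subset above c y.
Proof.
move=> cal; apply/fintype.subsetP => j; rewrite !finset.inE; apply: lt_trans.
by rewrite some_lt.
Qed.

(** If [A] had more mass under [mu], lift to [mu'] near [mu] the image [nu'] of [nu] under
    [squeeze c]. Then [mu'{above al in A} <= mu'{above c in A} = nu'{above c in A} = nu{above al in
    A}], the first step because [A] is upwards closed; this is a contradiction. *)
Lemma fibre_le_mass (mu nu : K) (A : {set {set 'I_k}}) : fibre_le mu nu -> up_closed A ->
  \sum_(B in A) mass mu B <= \sum_(B in A) mass nu B.
Proof.
move=> mn upA; rewrite -!(pr_above _ (mem A)) leNgt; apply/negP => lt.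
set Smu := pr mu _ in lt; set Snu := pr nu _ in lt.
pose S (rho : K) := pr rho [set y | mem A (above al y)].
have spS : cdf_span (grid be) S by exact: above_span.
have e0 : 0 < (Smu - Snu) / 2 by rewrite divr_gt0// subr_gt0.
have [V [[G eps] [/= Gbe eps0] GV] hV] := mn _ (cdf_span_near mu spS e0).
have [[b0 b0al] lim] := gal.1.
(* Only corner coordinates below [al] constrain [c], which must exceed them for the squeeze to
   preserve the boxes of [G]. *)
pose co (p : X * 'I_n) : option tau :=
    if p.1 p.2 is Some b then (if (b < al)%O then Some b else None) else None.
have [|c1 [_ c1al hc1]] := @finite_bound _ tau _ [seq (a, i) | a <- G,
    i <- enum 'I_n] b0 al co b0al.
  by move=> p b _; rewrite /co; case: (p.1 p.2) => // b'; case: ifP => // + [<-].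
have [c c1c cal] := lim _ c1al.
have [nu' nu'E] := radon_push nu (squeeze_continuous cal).
have nu'G a : a \in G -> box_cdf nu' a = box_cdf nu a.
  move=> aG; rewrite /box_cdf nu'E; last exact: borel_cle.
  congr pr; apply/seteqP; split=> y /cleP h; apply/cleP => i; have := h i.
    rewrite squeeze_le//; case: ifP => // /andP[ca aal].
    have := hc1 (a, i); move: ca aal; rewrite /co /=; case: (a i) => // b.
    rewrite some_le some_lt => cb bal /(_ b); rewrite bal => bc1.
    have /bc1/(_ erefl) : (a, i) \in [seq (a, i) | a <- G, i <- enum 'I_n].
      by apply/allpairsP; exists (a, i); rewrite mem_enum.
    by rewrite leNgt (lt_le_trans c1c cb).
  rewrite squeeze_le// => ya; case: ifP => // /andP[_ /ltW]; exact: le_trans.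
have [|mu' /= Smu' mu'nu'] := hV nu'.
  by apply: GV => a aG; rewrite nu'G// subrr normr0.
have Sc : pr mu' [set y | mem A (above c y)] = pr nu' [set y | mem A (above c y)].
  exact: cdf_span_eq (above_span _ cal) mu'nu'.
have le1 : S mu' <= pr mu' [set y | mem A (above c y)].
  apply: pr_le; [exact: above_borel|exact: above_borel|] => y /= yA.
  move/forall_inP : upA => /(_ _ yA)/forallP/(_ (above c y))/implyP; apply.
  exact: above_le.
have eq2 : pr nu' [set y | mem A (above c y)] = Snu.
  rewrite nu'E; last exact: above_borel.
  by congr pr; apply/seteqP; split=> y /=; rewrite above_squeeze.
rewrite Sc eq2 in le1; move: Smu'; rewrite -/Smu ltr_norml => /andP[_].
have -> : S mu = Smu by [].
by lra.
Qed.

(** * Rearranging measures in the fibre over the Dirac measure *)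

Definition in_fibre (mu : K) := forall a, grid al a -> box_cdf mu a = (cle x a)%:R.

(* A clopen set of full measure for all the measures in the fibre. *)
Definition near_x (G : seq X) : set X := [set y |
  (forall a i, a \in G -> (y i <= collapse al a i :> T)%O -> (x i <= collapse al a i :> T)%O) /\
  forall i, (y i <= x i :> T)%O].

Definition near_boxes (G : seq X) : seq X :=
  [seq coord_box i (collapse al a i) | a <- G,
      i <- enum 'I_n] ++ [seq coord_box i (x i) | i <- enum 'I_n].

Lemma near_x_depends G : depends_on (near_boxes G) (near_x G).
Proof.
move=> y z yz [h1 h2]; split=> [a i aG|i].
  rewrite -cle_coord_box -yz; last first.
    by rewrite mem_cat; apply/orP; left; apply/allpairsP; exists (a, i); rewrite mem_enum.
  by rewrite cle_coord_box; exact: h1.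
rewrite -cle_coord_box -yz ?cle_coord_box//.
by rewrite mem_cat; apply/orP; right; apply/mapP; exists i; rewrite ?mem_enum.
Qed.

Lemma near_boxes_grid G a : a \in near_boxes G -> grid al a.
Proof.
rewrite mem_cat => /orP[/allpairsP[[b i] /= [_ _ ->]]|/mapP[i _ ->]]; apply: grid_coord_box.
  exact: grid_collapse.
by case E: (x i) => [b|//]; exact: gal.2 E.
Qed.

Lemma near_x_self G : near_x G x.
Proof. by split. Qed.

Lemma near_x_borel G : borel (near_x G).
Proof. exact: clopen_borel (depends_on_clopen htau (@near_x_depends G)). Qed.

(** The mass of this set is a combination of box masses at grid corners, so it is the same as for
    the Dirac measure at [x]. *)
Lemma near_x_full G mu : in_fibre mu -> pr mu (near_x G) = 1.
Proof.
move=> mux; have sp : cdf_span (grid al) (fun mu : K => pr mu (near_x G)).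
  apply: cdf_span_pr (@near_x_depends G) => //; first exact: grid_min.
  exact: near_boxes_grid.
rewrite (cdf_span_eq (nu := radon_dirac R x hX) sp).
  rewrite pr_dirac; last exact: near_x_borel.
  by rewrite indicE mem_set//; exact: near_x_self.
move=> a ga; rewrite mux// /box_cdf pr_dirac; last exact: borel_cle.
by rewrite indicE; congr ((nat_of_bool _)%:R); apply/idP/idP; rewrite inE.
Qed.

(* [z] prescribes the coordinates above [al]; the remaining coordinates in [B]
   are sent to [al], and those outside [B] are kept. This is invisible from
   [grid al] when [above al y = B]. *)
Definition graft (z : X) (B : {set 'I_k}) (y : X) : X := fun i =>
  if (above al z \subset B) && (i \in e @: B)%SET then Order.max (z i : T) (Some al : T)
      else y i.

Lemma graft_continuous z B : continuous (graft z B).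
Proof.
have cb (b : bool) : clopen [set y : X | b].
  have [->|->] : [set y : X | b] = setT \/ [set y : X | b] = set0.
  - by case: b; [left|right]; apply/seteqP; split.
  - exact: clopenT.
  - exact: clopen0.
apply: cube_continuous => i u; rewrite /graft.
by case: ((above al z \subset B) && _); [exact: cb|exact: clopen_coord].
Qed.

(** On the coordinates in [B] both [y] and its graft are at least [al], whereas a grid corner is
    below [al] or unconstrained there. *)
Lemma cle_graft_grid z B y a : grid al a -> above al y = B -> cle (graft z B y) a = cle y a.
Proof.
move=> ga yB; apply: eq_forallb => i; rewrite /graft; case: ifP => // /andP[_ /imsetP[j jB ->]].
have := ga (e j); have : (Some al < y (e j) :> T)%O by move: jB; rewrite -yB finset.inE.
case: (a (e j)) => [b|] /=; last by rewrite !le_right_end.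
move=> ay bal; rewrite ge_max [X in _ && X]leNgt some_lt bal andbF.
by apply/esym/negbTE; rewrite -ltNge (lt_trans _ ay)// some_lt.
Qed.

Lemma near_x_le G y a i : near_x G y -> a \in G -> ~~ (Some al <= a i :> T)%O ->
  (y i <= a i :> T)%O = (x i <= a i :> T)%O.
Proof.
move=> [h1 h2] aG; rewrite -ltNge => aal.
have aE : collapse al a i = a i.
  by rewrite /collapse; move: aal; case: (a i) => [b|//]; rewrite some_lt /= => ->.
by apply/idP/idP => h; [have := h1 a i aG; rewrite aE; apply|exact: le_trans h].
Qed.

(** Corner coordinates below [al] only see [x]. At the others, coordinates in [B] come from [z];
    those outside [B] where [x] is the endpoint are at most [al] for both points; the rest are
    bounded by coordinates of [x] below [al]. *)
Lemma cle_graft_near G z B y a : near_x G y -> near_x G z -> a \in G ->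
  above al y = B -> above al z \subset B -> cle (graft z B y) a = cle z a.
Proof.
move=> ny nz aG yB zB; apply: eq_forallb => i; rewrite /graft zB /=.
have [ala|ala] := boolP (Some al <= a i :> T)%O; last first.
  rewrite (near_x_le nz aG ala); case: ifPn => [/imsetP[j _ ij]|_];
      last exact: near_x_le ny aG ala.
  rewrite ge_max (negbTE ala) andbF; apply/esym/negbTE.
  have -> : x i = right_end by apply/e_range; exists j.
  by apply: contra ala; apply: le_trans; exact: le_right_end.
case: ifPn => [_|iB]; first by rewrite ge_max ala andbT.
have [xi|xi] := eqVneq (x i) right_end.
  have [j ji] := (e_range i).1 xi.
  have jB : j \notin B by apply: contra iB => jB; apply/imsetP; exists j.
  have nab w : j \notin above al w -> (w i <= a i :> T)%O.
    by rewrite finset.inE -leNgt ji => /le_trans; apply.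
  rewrite !nab//; first by apply: contra jB => /(fintype.subsetP zB).
  by rewrite yB.
have xa : (x i <= a i :> T)%O.
  apply: le_trans ala; move: xi; case E: (x i) => [b|//] _.
  by rewrite some_le ltW//; exact: gal.2 E.
by rewrite (le_trans (ny.2 i) xa) (le_trans (nz.2 i) xa).
Qed.

(** Hall's theorem couples the cells of a finite partition, weighted by [mu], with the sets [B],
    weighted by [nu]; its kernel tells which cell representatives to graft onto the part of [nu']
    where [above al] is [B]. *)
Lemma mass_fibre_le (mu nu : K) : in_fibre mu -> in_fibre nu ->
  (forall A : {set {set 'I_k}}, up_closed A ->
     \sum_(B in A) mass mu B <= \sum_(B in A) mass nu B) ->
  fibre_le mu nu.
Proof.
move=> mux nux dom U [[G eps] [/= Gbe eps0] GU].
pose N := near_x G; have bN : borel N by exact: near_x_borel.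
have muN : pr mu N = 1 by exact: near_x_full.
have nuN : pr nu N = 1 by exact: near_x_full.
(* The partition has to decide the boxes in [G], membership in [N] and the value of [above al]. *)
pose H := G ++ near_boxes G ++ above_boxes al.
pose C := (size H).-tuple bool.
pose z (c : C) : X := cell_rep c.
(* The indicator makes the weight vanish when the representative is outside [N], so the kernel
   selects such cells only where [mass nu B] is zero. *)
pose p (c : C) : R := \1_N (z c) * pr mu (cell c).
have p0 c : 0 <= p c by rewrite mulr_ge0 ?pr_ge0// indicE.
have depH A0 A : {subset A0 <= H} -> depends_on A0 A -> depends_on H A.
  by move=> sub dA y y' yy'; apply: dA => a aA; apply: yy'; exact: sub.
have subN : {subset near_boxes G <= H}.
  by move=> a aG; rewrite /H mem_cat; apply/orP; right; rewrite mem_cat; apply/orP; left.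
have subA : {subset above_boxes al <= H}.
  by move=> a aG; rewrite /H mem_cat; apply/orP; right; rewrite mem_cat; apply/orP; right.
have depN : depends_on H N by exact: depH subN (@near_x_depends G).
have depI A1 A2 : depends_on H A1 -> depends_on H A2 -> depends_on H (A1 `&` A2).
  by move=> d1 d2 y y' yy' [/(d1 _ _ yy') ? /(d2 _ _ yy') ?].
have sum_p (P : pred X) : depends_on H [set y | P y] ->
    pr mu [set y | P y] = \sum_(c | P (z c)) p c.
  move=> dP; have bP : borel [set y | P y] by exact: clopen_borel (depends_on_clopen htau dP).
  rewrite -(pr_full bP bN muN) (pr_cells htau mu (depI _ _ dP depN)) [RHS]big_mkcond /=.
  apply: eq_bigr => c _; rewrite indicI /= /p -/(z c) -mulrA; case: ifPn => Pz.
    by rewrite [\1_[set y | P y] _]indicE mem_set// mul1r.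
  by rewrite [\1_[set y | P y] _]indicE memNset ?mul0r//; exact/negP.
have depab (P : pred {set 'I_k}) : depends_on H [set y | P (above al y)].
  exact: depH subA (above_depends (P := P)).
pose rl (c : C) (B : {set 'I_k}) := above al (z c) \subset B.
have sum_mass rho : \sum_B mass rho B = 1.
  have := pr_above rho predT; rewrite (_ : [set y | _] = setT) ?prT; first by move=> ->.
  by apply/seteqP; split.
have hl : hall rl p (mass nu).
  split=> // [B||Y]; first exact: pr_ge0.
    rewrite sum_mass -(prT mu); have := sum_p predT; rewrite (_ : [set y | _] = setT);
        last by apply/seteqP; split.
    by move=> ->.
  (* Upward closure makes the domination hypothesis applicable, and it yields Hall's inequality. *)
  have upY : up_closed (neighbours rl Y).
    apply/forall_inP => B; rewrite finset.inE => /existsP[c /andP[cY cB]].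
    apply/forallP => B'; apply/implyP => BB'; rewrite finset.inE; apply/existsP; exists c.
    by rewrite cY; exact: fintype.subset_trans BB'.
  apply: le_trans (dom _ upY); rewrite -(pr_above mu (mem (neighbours rl Y))).
  rewrite (sum_p (fun y => above al y \in neighbours rl Y));
      last exact: (depab (mem (neighbours rl Y))).
  rewrite [leRHS](bigID (mem Y)) /= -[leLHS]addr0; apply: lerD; last exact: sumr_ge0.
  rewrite le_eqVlt; apply/orP; left; apply/eqP/eq_bigl => c; apply/esym/andb_idl => cY;
      rewrite finset.inE; apply/existsP; exists c; rewrite cY /rl.
  exact: fintype.subxx.
have [kappa [k0 k1 kp ke]] := hall_kernel [tuple of nseq (size H) true] hl.
have kN B c : mass nu B * kappa B c != 0 -> rl c B /\ N (z c).
  move=> ne; split; first exact: ke.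
  apply: contrapT => nN; have /eqP := kp c;
      rewrite /p indicE memNset// mul0r psumr_eq0 => [|B' _].
    by move=> /allP/(_ B (mem_index_enum _))/eqP E; rewrite E eqxx in ne.
  by rewrite mulr_ge0// pr_ge0.
pose fib B := [set y | above al y = B].
have bfib B : borel (fib B).
  have := @above_borel al (pred1 B); congr borel; by apply/seteqP; split=> y /eqP.
have bI (A1 A2 : set X) : borel A1 -> borel A2 -> borel (A1 `&` A2).
  by move=> m1 m2; exact: (@measurableI _ (g_sigma_algebraType (@open X)) _ _ m1 m2).
have bNC : borel (~` N) by exact: (@measurableC _ (g_sigma_algebraType (@open X)) _ bN).
pose m := #|{set 'I_k}|.
(* One share of [eps] for each [B], and one for the mass outside [N]. *)
pose dl := eps / (m%:R + 1).
have m10 : 0 < m%:R + 1 :> R by rewrite ltr_wpDl.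
have dl0 : 0 < dl by rewrite divr_gt0.
pose V := [set nu' : K | (forall B, `|pr nu (fib B `&` N) - pr nu' (fib B `&` N)| < dl) /\
  `|pr nu N - pr nu' N| < dl].
have spI A0 A : {subset A0 <= near_boxes G ++ above_boxes al} -> depends_on A0 A ->
    cdf_span (grid be) (fun rho : K => pr rho A).
  move=> sub; apply: cdf_span_pr => //; first exact: grid_min.
  move=> a /sub; rewrite mem_cat => /orP[/near_boxes_grid|]; first exact/grid_le/ltW.
  exact: above_boxes_grid.
exists V.
  have f2 : \forall nu' \near cdf_nbhs (grid be) nu, `|pr nu N - pr nu' N| < dl.
    by apply: cdf_span_near => //; apply: spI (@near_x_depends G) => a aG; rewrite mem_cat aG.
  suff f1 : \forall nu' \near cdf_nbhs (grid be) nu, forall B,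
      `|pr nu (fib B `&` N) - pr nu' (fib B `&` N)| < dl.
    exact: (filterS2 _ _ f1 f2).
  apply: filter_forall => B; apply: cdf_span_near => //.
  apply: (spI (near_boxes G ++ above_boxes al)) => // y y' yy' [yB yN]; split.
    have dB : depends_on (above_boxes al) [set y | pred1 B (above al y)] by exact:
        above_depends.
    by apply/eqP/(dB y) => [a aG|]; [apply: yy'; rewrite mem_cat aG orbT|exact/eqP].
  by apply: near_x_depends yN => a aG; apply: yy'; rewrite mem_cat aG.
move=> nu' [V1 V2].
have [||||mu' mu'E] := @radon_mix R X hX (C * {set 'I_k})%type (fun q => kappa q.2 q.1)
   (fun q => fib q.2) (fun q => graft (z q.1) q.2) nu'.
- by move=> q.
- move=> q; apply: (depends_on_clopen htau (G := above_boxes al)).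
  have dB : depends_on (above_boxes al) [set y | pred1 q.2 (above al y)] by exact:
      above_depends.
  by move=> y y' yy' /= yB; apply/eqP/(dB y) => //; exact/eqP.
- by move=> q; exact: graft_continuous.
- rewrite -(pair_bigA _ (fun c B => kappa B c * pr nu' (fib B))) /= exchange_big /=.
  by under eq_bigr do rewrite -mulr_suml k1 mul1r; exact: sum_mass.
have mu'cdf a : box_cdf mu' a =
    \sum_B \sum_c kappa B c * pr nu' (fib B `&` [set y | cle (graft (z c) B y) a]).
  rewrite /box_cdf mu'E; last exact: borel_cle.
  by rewrite -(pair_bigA _ (fun c B =>
      kappa B c * pr nu' (fib B `&` graft (z c) B @^-1` [set y | cle y a]))) /= exchange_big.
exists mu'; last first.
  move=> a ga; rewrite mu'cdf.
  have := @pr_partition R X _ (above al) nu' [set y | cle y a] predT (borel_cle htau a) bfib.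
  rewrite (_ : [set y | predT _] = setT); last by apply/seteqP; split.
  rewrite setTI /box_cdf => ->; apply: eq_bigr => B _.
  transitivity (\sum_c kappa B c * pr nu' (fib B `&` [set y | cle y a]));
      last by rewrite -mulr_suml k1 mul1r.
  apply: eq_bigr => c _; congr (_ * pr _ _); apply/seteqP; split=> y [yB /= ya]; split=> //=.
    by rewrite cle_graft_grid in ya.
  by rewrite cle_graft_grid.
apply: GU => a aG.
(* The conditional mass of the box at [a] given [B], computed on cell representatives. *)
pose th B : R := \sum_c kappa B c * (cle (z c) a)%:R.
pose v B := pr nu (fib B `&` N). pose v' B := pr nu' (fib B `&` N).
have vE B : mass nu B = v B by rewrite /v pr_full.
have th01 B : 0 <= th B <= 1.
  apply/andP; split; first by apply: sumr_ge0 => c _; rewrite mulr_ge0 ?k0.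
  by rewrite -(k1 B); apply: ler_sum => c _; rewrite ler_piMr ?k0//; case: (cle _ _).
have muE : box_cdf mu a = \sum_B v B * th B.
  rewrite /box_cdf (sum_p (fun y => cle y a)).
    rewrite big_mkcond /=; under [RHS]eq_bigr do rewrite /th mulr_sumr.
    rewrite exchange_big /=; apply: eq_bigr => c _.
    rewrite -kp; case: ifP => _; last by rewrite big1// => B _; rewrite !mulr0.
    by apply: eq_bigr => B _; rewrite mulr1 vE.
  by move=> y y' yy' /=; rewrite yy'// mem_cat aG.
have bH c B : borel [set y | cle (graft (z c) B y) a].
  exact: (continuous_borel (@graft_continuous (z c) B) (borel_cle htau a)).
pose Q B := \sum_c kappa B c * pr nu' ((fib B `&` [set y | cle (graft (z c) B y) a]) `&` N).
pose Er B := \sum_c kappa B c * pr nu' ((fib B `&` [set y | cle (graft (z c) B y) a]) `&` ~` N).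
have mu'QE : box_cdf mu' a = \sum_B (Q B + Er B).
  rewrite mu'cdf; apply: eq_bigr => B _; rewrite -big_split /=; apply: eq_bigr => c _.
  by rewrite -mulrDr -prID//; exact: bI.
have Er0 B : 0 <= Er B by apply: sumr_ge0 => c _; rewrite mulr_ge0// pr_ge0.
have ErN B : Er B <= pr nu' (fib B `&` ~` N).
  rewrite -[leRHS]mul1r -(k1 B) mulr_suml ler_sum// => c _; rewrite ler_wpM2l//.
  by apply: pr_le; [exact: (bI _ _ (bI _ _ (bfib B) (bH c B)))|exact: (bI _ _ (bfib
      B))|move=> y [[]]].
(* If [v B] is zero the kernel is uncontrolled and [Q B] is only bounded by [v' B]; otherwise
   grafting is exact on [N] and [Q B] equals [v' B * th B]. *)
have QB B : `|v B * th B - Q B| <= `|v B - v' B|.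
  have [v0|vn0] := eqVneq (v B) 0.
    rewrite v0 mul0r !sub0r !normrN !ger0_norm ?pr_ge0//.
      rewrite -[leRHS]mul1r -(k1 B) mulr_suml ler_sum// => c _; rewrite ler_wpM2l//.
      by apply: pr_le; [exact: (bI _ _ (bI _ _ (bfib B) (bH c B)))|exact: (bI _ _ (bfib
          B))|move=> y [[]]].
    by apply: sumr_ge0 => c _; rewrite mulr_ge0// pr_ge0.
  have -> : Q B = v' B * th B.
    rewrite /Q /th mulr_sumr; apply: eq_bigr => c _.
    have [->|kn0] := eqVneq (kappa B c) 0; first by rewrite !mul0r mulr0.
    have [zB zN] : rl c B /\ N (z c) by apply: kN; rewrite mulf_neq0// vE.
    rewrite [RHS]mulrCA; congr (_ * _); case: (boolP (cle (z c) a)) => za.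
      rewrite mulr1 /v'; congr pr; apply/seteqP; split=> y; first by move=> [[]].
      by move=> [yB yN]; do !split=> //=; rewrite (cle_graft_near yN zN).
    rewrite mulr0 -[RHS](pr0 nu'); congr pr; apply/seteqP; split=> y //= [[yB ya] yN].
    by rewrite (cle_graft_near yN zN)// (negbTE za) in ya.
  rewrite -mulrBl normrM ler_piMr// ger0_norm; by case/andP: (th01 B).
have sumE : \sum_B pr nu' (fib B `&` ~` N) = pr nu N - pr nu' N.
  rewrite nuN -prC//; have := @pr_partition R X _ (above al) nu' (~` N) predT bNC bfib.
  rewrite (_ : [set y | predT _] = setT); last by apply/seteqP; split.
  by rewrite setTI => <-.
rewrite muE mu'QE -sumrB.
apply: (@le_lt_trans _ _ (\sum_B (`|v B - v' B| + pr nu' (fib B `&` ~` N)))).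
  apply: le_trans (ler_norm_sum _ _ _) _; apply: ler_sum => B _.
  rewrite opprD addrA; apply: le_trans (ler_normB _ _) _; apply: lerD; first exact: QB.
  by rewrite ger0_norm.
rewrite big_split /= sumE.
have -> : eps = m%:R * dl + dl.
  by rewrite -[X in _ + X]mul1r -mulrDl mulrC divfK// gt_eqF.
apply: ler_ltD; last exact: le_lt_trans (ler_norm _) V2.
rewrite /m -sum1_card natr_sum mulr_suml; apply: ler_sum => B _.
by rewrite mul1r; exact: ltW (V1 B).
Qed.

(** A mixture of point masses at the [z B]: where [x] is the endpoint, [z B] keeps it on [B] and
    takes the value [al] elsewhere. No grid corner tells these values apart, while [above al]
    does. *)
Lemma mass_surjective (t : {set 'I_k} -> R) : (forall B, 0 <= t B) -> \sum_B t B = 1 ->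
  exists2 mu : K, in_fibre mu & forall B, mass mu B = t B.
Proof.
move=> t0 t1.
pose z (B : {set 'I_k}) : X := fun i =>
  if x i == right_end then (if i \in (e @: B)%SET then right_end else Some al) else x i.
have [||||mu muE] := @radon_mix R X hX {set 'I_k} t (fun=> setT) (fun B =>
    cst (z B)) (radon_dirac R x hX).
- by [].
- by move=> B; exact: clopenT.
- by move=> B; exact: cst_continuous.
- by under eq_bigr do rewrite prT mulr1.
have {}muE (P : pred X) : borel [set y | P y] ->
    pr mu [set y | P y] = \sum_B t B * (P (z B))%:R.
  move=> bP; rewrite muE//; apply: eq_bigr => B _; rewrite setTI; congr (_ * _).
  rewrite /preimage /=; case: (P (z B)).
    by rewrite (_ : mkset _ = setT) ?prT//; apply/seteqP; split.
  by rewrite (_ : mkset _ = set0) ?pr0//; apply/seteqP; split.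
exists mu => [a ga|B].
  rewrite /box_cdf muE; last exact: borel_cle.
  rewrite (eq_bigr (fun B => t B * (cle x a)%:R)); first by rewrite -mulr_suml t1 mul1r.
  move=> B _; congr (_ * (nat_of_bool _)%:R); apply: eq_forallb => i; rewrite /z.
  case: eqP => // ->; have := ga i; case: (a i) => [b|] /=; last by rewrite !le_right_end.
  move=> bal; case: ifP => // _; rewrite some_le leNgt bal; apply/esym/negbTE.
  by rewrite -ltNge some_lt_right_end.
rewrite /mass (_ : [set y | _] = [set y | pred1 B (above al y)]); last first.
  by apply/seteqP; split=> y /eqP.
rewrite muE; last exact: above_borel.
have zE B' : above al (z B') = B'.
  apply/finset.setP => j; rewrite finset.inE /z (e_range (e j)).2 ?eqxx; last by exists j.
  rewrite mem_imset//; case: (j \in B'); first by rewrite some_lt_right_end.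
  by rewrite ltxx.
rewrite (bigD1 B) //= zE eqxx mulr1 big1 ?addr0// => B' BB'.
by rewrite zE (negbTE BB') mulr0.
Qed.

(** * Descent to the quotient spaces *)

Local Notation L := (truncation R n al).
Local Notation L' := (truncation R n be).
Context (q : quotient_space L' -> quotient_space L) (hq : natural_projection q).
Local Notation y0 := (quotient_proj L (radon_dirac R x hX)).

Lemma q_proj (mu : K) : q (quotient_proj L' mu) = quotient_proj L mu.
Proof. by have [_ _ <-] := hq. Qed.

Definition fibre_rep (s : fiber q y0) : K := repr (fiber_val s).

Lemma proj_fibre_rep s : quotient_proj L' (fibre_rep s) = fiber_val s.
Proof. exact: quotient_projK. Qed.

Lemma proj_eq (mu nu : K) : quotient_proj L mu = quotient_proj L nu <->
  forall a, grid al a -> box_cdf mu a = box_cdf nu a.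
Proof.
by split=> [/quotient_projP/truncationP//|h]; apply/quotient_projP/truncationP.
Qed.

Lemma dirac_cdf a : box_cdf (radon_dirac R x hX) a = (cle x a)%:R.
Proof.
rewrite /box_cdf pr_dirac; last exact: borel_cle.
by rewrite indicE; congr ((nat_of_bool _)%:R); apply/idP/idP; rewrite inE.
Qed.

Lemma fibre_rep_in s : in_fibre (fibre_rep s).
Proof.
have : q (fiber_val s) = y0 by exact: (set_valP s).
rewrite -proj_fibre_rep q_proj => /proj_eq h a ga.
by rewrite h// dirac_cdf.
Qed.

Lemma in_fibre_exists mu : in_fibre mu ->
    exists s : fiber q y0, fiber_val s = quotient_proj L' mu.
Proof.
move=> mux; have qmu : (q @^-1` [set y0]) (quotient_proj L' mu).
  rewrite /= q_proj; apply/proj_eq => a ga; by rewrite mux// dirac_cdf.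
by exists (SigSub (mem_set qmu) : fiber q y0).
Qed.

(** Conditions at corners of [grid be] are constant on classes, so they hold for whatever
    representative is chosen. *)
Lemma cdf_nbhs_saturated (mu : K) U : cdf_nbhs (grid be) mu U ->
  exists2 W, nbhs (quotient_proj L' mu) W & forall w, W w -> U (repr w).
Proof.
move=> [[G eps] [/= Gbe eps0] GU].
exists [set w : quotient_space L' | forall a, a \in G ->
    `|box_cdf mu a - box_cdf (repr w) a| < eps].
  apply/truncation_nbhs => //; exists (G, eps) => //= nu h a aG.
  by rewrite cdf_repr; [exact: h|exact: Gbe].
by move=> w Ww; exact: GU.
Qed.

Lemma fiber_leE (s t : fiber q y0) : fiber_le s t <-> fibre_le (fibre_rep s) (fibre_rep t).
Proof.
split=> [/asboolP st U /cdf_nbhs_saturated[W]|st].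
  rewrite proj_fibre_rep => nW WU; have [V nV VW] := st _ nW.
  exists (quotient_proj L' @^-1` V); first by apply/truncation_nbhs => //;
      rewrite proj_fibre_rep.
  move=> nu' Vnu'; have [w Ww qw] : (q @` W) (q (quotient_proj L' nu')).
    by apply: VW; exists (quotient_proj L' nu').
  exists (repr w); first exact: WU.
  by apply/proj_eq; rewrite -!q_proj quotient_projK.
apply/asboolP => U; rewrite -proj_fibre_rep =>
    /truncation_nbhs-/(_ htau)/st[V /cdf_nbhs_saturated[W nW WV] hV].
exists W; first by rewrite -proj_fibre_rep.
move=> _ [w Ww <-]; have [mu' Umu' /proj_eq E] := hV _ (WV _ Ww).
exists (quotient_proj L' mu') => //.
by rewrite -(quotient_projK w) !q_proj.
Qed.

Lemma mass_proj (mu nu : K) B : quotient_proj L' mu = quotient_proj L' nu ->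
    mass mu B = mass nu B.
Proof.
by move=> /quotient_projP/truncationP h; exact: cdf_span_eq (mass_span B) h.
Qed.

Lemma mass_simplex (mu : K) :
  [forall B, 0 <= [ffun B => mass mu B] B <= 1] && (\sum_B [ffun B => mass mu B] B == 1).
Proof.
have s1 : \sum_B mass mu B = 1.
  have := pr_above mu predT; rewrite (_ : [set y | _] = setT) ?prT; first by move=> ->.
  by apply/seteqP; split.
apply/andP; split; last by under eq_bigr do rewrite ffunE; rewrite s1.
apply/forallP => B; rewrite ffunE pr_ge0 /= -s1 (bigD1 B) //= lerDl.
by apply: sumr_ge0 => B' _; exact: pr_ge0.
Qed.

Definition fibre_mass (s : fiber q y0) : cube_simplex R k :=
  exist _ [ffun B => mass (fibre_rep s) B] (mass_simplex (fibre_rep s)).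

Lemma fibre_mass_le (s t : fiber q y0) : (s <= t)%O = (fibre_mass s <= fibre_mass t)%O.
Proof.
apply/idP/idP => [/fiber_leE st|/forallP st].
  apply/forallP => A; apply/implyP => uA /=.
  under eq_bigr do rewrite ffunE; under [leRHS]eq_bigr do rewrite ffunE.
  exact: fibre_le_mass.
apply/fiber_leE; apply: mass_fibre_le => [||A uA]; try exact: fibre_rep_in.
have := implyP (st A) uA => /=.
by under eq_bigr do rewrite ffunE; under [X in _ <= X -> _]eq_bigr do rewrite ffunE.
Qed.

Lemma fibre_mass_surjective (t : cube_simplex R k) : exists s, fibre_mass s = t.
Proof.
have /andP[/forallP t01 /eqP t1] := svalP t.
have [|mu mux muE] := mass_surjective _ t1; first by move=> B; case/andP: (t01 B).
have [s sE] := in_fibre_exists mux; exists s; apply/val_inj/ffunP => B /=.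
by rewrite ffunE -muE; apply: mass_proj; rewrite proj_fibre_rep.
Qed.

Lemma fibre_order_isomorphic : order_isomorphic (fiber_order q y0) (cube_simplex R k).
Proof.
exact: (antisymmetrization_isomorphic fibre_mass_le fibre_mass_surjective).
Qed.

End fibre.

Lemma truncation_lt (R : realType) d (tau : orderType d) n (al be : tau) :
  quotient_lt (truncation R n al) (truncation R n be) -> (al < be)%O.
Proof.
by move=> [_ nle]; rewrite ltNge; apply/negP => ba; apply: nle; exact: truncation_le.
Qed.

Theorem theorem8p3 (R : realType) (d : Order.disp_t) (tau : orderType d)
    (htau : uncountable_regular_cardinal tau) (n : nat) (hn : (1 <= n)%N)
    (x : ordinal_cube tau n) (k : nat)
    (hk : k = #|[set i : 'I_n | x i == right_end]%SET|) :
  @local_order_cong tau (radon_probability R (ordinal_cube tau n))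
    (radon_dirac R x (@ordinal_cube_hausdorff d tau n))
    simplex_display (cube_simplex R k).
Proof.
exists (@truncations R d tau n x); split.
- exact: truncations_small.
- exact: truncations_cofinal.
- exact: truncations_semilattice.
move=> L L' q [al gal LE] [be _ L'E]; subst L L' k => /truncation_lt albe hq.
(* [enum_val] lists the coordinates at which [x] is the endpoint. *)
apply: (fibre_order_isomorphic htau gal albe (e := enum_val)) hq; first exact: enum_val_inj.
move=> i; split=> [xi|[j <-]]; last by have := enum_valP j; rewrite finset.inE => /eqP.
have iJ : i \in [set i : 'I_n | x i == right_end]%SET by rewrite finset.inE xi.
by exists (enum_rank_in iJ i); rewrite enum_rankK_in.
Qed.
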